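(* Let $k\le n$ be positive integers and let $\lambda$ be a partition of $k$. There is an isomorphism of graded rings $$R_{n,\lambda}\cong\mathbb{Q}[\overline{O}_{n,\lambda'}\cap\mathfrak{t}],$$ where the right-hand side is the coordinate ring of the scheme-theoretic intersection, and the isomorphism is given by mapping $x_i$ to $x_{i,i}$.
   Context: For a partition $\lambda$ of $k$, $\lambda'$ denotes the conjugate partition, $\lambda'_j=\#\{i:\lambda_i\ge j\}$, padded by zeros. Let $\mathbf{x}_n=\{x_1,\dots,x_n\}$. For $S\subseteq\mathbf{x}_n$ and $d\ge1$, $e_d(S)$ is the sum of all squarefree monomials of degree $d$ in the variables in $S$ (so $e_d(S)=0$ if $d>|S|$). For $0\le m\le n$ let $p^n_m(\lambda)=\lambda'_n+\lambda'_{n-1}+\dots+\lambda'_{n-m+1}$. Define $$I_{n,\lambda}=\langle e_d(S):S\subseteq\mathbf{x}_n,\ d>|S|-p^n_{|S|}(\lambda)\rangle,\qquad R_{n,\lambda}=\mathbb{Q}[\mathbf{x}_n]/I_{n,\lambda}.$$ Let $\mathfrak{gl}_n$ be the space of $n\times n$ matrices over $\mathbb{Q}$ with coordinate ring $\mathbb{Q}[x_{i,j}:1\le i,j\le n]$. For a partition $\mu$ of $k\le n$, the Eisenbud–Saltman rank variety is $\overline{O}_{n,\mu}=\{X\in\mathfrak{gl}_n:\dim\ker X^d\ge\mu'_1+\dots+\mu'_d,\ d=1,\dots,n\}$, with defining (vanishing) ideal $I(\overline{O}_{n,\mu})$. Let $\mathfrak{t}\subseteq\mathfrak{gl}_n$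 be the set of diagonal matrices, with ideal $I(\mathfrak{t})=\langle x_{i,j}:i\ne j\rangle$. The coordinate ring of the scheme-theoretic intersection is $\mathbb{Q}[\overline{O}_{n,\mu}\cap\mathfrak{t}]=\mathbb{Q}[x_{i,j}]/(I(\overline{O}_{n,\mu})+I(\mathfrak{t}))$, graded by polynomial degree. *)

(* Defs.v *)
From HB Require Import structures.
From mathcomp Require Import all_boot all_order all_algebra.
From mathcomp Require Import boolp.
From mathcomp Require Import mpoly zify.

Set Implicit Arguments.
Unset Strict Implicit.
Unset Printing Implicit Defensive.

Import GRing.Theory.

Local Open Scope ring_scope.
Local Open Scope quotient_scope.

(* The last two axioms say that the ring is the internal direct sum of its    *)
(* pieces.                                                                    *)
Record gradedRing := GradedRing {
  gr_sort :> comNzRingType;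
  gr_piece : nat -> gr_sort -> Prop;
  _ : forall d, gr_piece d 0;
  _ : forall d a b, gr_piece d a -> gr_piece d b -> gr_piece d (a - b);
  _ : gr_piece 0%N 1;
  _ : forall d e a b,
      gr_piece d a -> gr_piece e b -> gr_piece (d + e)%N (a * b);
  _ : forall a, exists N (c : nat -> gr_sort),
      (forall d, gr_piece d (c d)) /\ a = \sum_(d < N) c d;
  _ : forall N (c : nat -> gr_sort), (forall d, gr_piece d (c d)) ->
      \sum_(d < N) c d = 0 -> forall d, (d < N)%N -> c d = 0
}.

Definition graded_iso (A B : gradedRing) (f : {rmorphism A -> B}) : Prop :=
  bijective f /\ forall d a, gr_piece d a <-> gr_piece d (f a).

Section Ideals.

Variable R : comNzRingType.
Implicit Types (G I J : R -> Prop) (p q : R).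

Definition is_ideal I : Prop :=
  [/\ I 0, forall p q, I p -> I q -> I (p + q) & forall a p, I p -> I (a * p)].

Definition gen_ideal G p : Prop :=
  exists s : seq (R * R), (forall u, u \in s -> G u.2) /\
                          p = \sum_(u <- s) u.1 * u.2.

Definition add_ideal I J p : Prop :=
  exists q r, [/\ I q, J r & p = q + r].

Lemma gen_ideal_is_ideal G : is_ideal (gen_ideal G).
Proof.
split=> [|p q [s [Gs ->]] [t [Gt ->]]|a p [s [Gs ->]]].
- by exists [::]; rewrite big_nil.
- exists (s ++ t); rewrite big_cat; split=> // u.
  by rewrite mem_cat => /orP[/Gs|/Gt].
exists [seq (a * u.1, u.2) | u <- s]; split=> [u /mapP[v /Gs Gv ->] //|].
by rewrite big_map mulr_sumr; apply: eq_bigr => u _ /=; rewrite mulrA.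
Qed.

Lemma gen_idealS G I p : is_ideal I -> (forall g, G g -> I g) ->
  gen_ideal G p -> I p.
Proof.
move=> [I0 ID IM] GI [s [Gs ->]].
elim: s Gs => [|u s IHs] Gs; rewrite ?big_nil ?big_cons //.
apply: ID; first by apply/IM/GI/Gs/mem_head.
by apply: IHs => v vs; apply: Gs; rewrite inE vs orbT.
Qed.

Lemma add_ideal_is_ideal I J :
  is_ideal I -> is_ideal J -> is_ideal (add_ideal I J).
Proof.
move=> [I0 ID IM] [J0 JD JM]; split.
- by exists 0, 0; rewrite addr0.
- move=> _ _ [p [q [Ip Jq ->]]] [p' [q' [Ip' Jq' ->]]].
  by exists (p + p'), (q + q'); rewrite addrACA; split; auto.
move=> a _ [p [q [Ip Jq ->]]].
by exists (a * p), (a * q); rewrite mulrDr; split; auto.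
Qed.

Lemma ideal_sum I (T : Type) (s : seq T) (P : pred T) (F : T -> R) :
  is_ideal I -> (forall i, P i -> I (F i)) -> I (\sum_(i <- s | P i) F i).
Proof. by move=> [I0 ID IM] IF; apply: (big_ind I). Qed.

End Ideals.

Definition homogeneous (N : nat) (I : {mpoly rat[N]} -> Prop) : Prop :=
  forall d p, I p -> I (pihomog mdeg d p).

(* Properness is required because {ideal_quot _} is a nonzero ring.            *)
Record homogIdeal (N : nat) := HomogIdeal {
  hi_mem :> {mpoly rat[N]} -> Prop;
  hi_ideal : is_ideal hi_mem;
  hi_proper : ~ hi_mem 1;
  hi_homog : homogeneous hi_mem
}.

Section GradedQuotient.

Variables (N : nat) (I : homogIdeal N).

Definition hi_pred (p : {mpoly rat[N]}) : bool := `[< I p >].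

Lemma hi_idealr_closed : idealr_closed hi_pred.
Proof.
have [I0 ID IM] := hi_ideal I; split.
- exact/asboolP.
- exact/asboolP/(@hi_proper _ I).
by move=> a u v /asboolP Iu /asboolP Iv; apply/asboolP/ID => //; apply: IM.
Qed.

HB.instance Definition _ :=
  isIdealr.Build {mpoly rat[N]} hi_pred hi_idealr_closed.

Definition hi_idealr : idealr {mpoly rat[N]} := hi_pred.

Definition quot_ring : comNzRingType := {ideal_quot hi_idealr}.

Definition quot_class (p : {mpoly rat[N]}) : quot_ring :=
  \pi_{ideal_quot hi_idealr} p.

Definition quot_piece (d : nat) (a : quot_ring) : Prop :=
  exists2 p : {mpoly rat[N]}, p \is d.-homog & a = quot_class p.

Lemma quot_class_is_zmod_morphism : zmod_morphism quot_class.
Proof. by move=> p q; rewrite /quot_class raddfB. Qed.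

Lemma quot_class_is_monoid_morphism : monoid_morphism quot_class.
Proof. by split=> [|p q]; rewrite /quot_class ?rmorph1 ?rmorphM. Qed.

HB.instance Definition _ := GRing.isZmodMorphism.Build
  {mpoly rat[N]} quot_ring quot_class quot_class_is_zmod_morphism.
HB.instance Definition _ := GRing.isMonoidMorphism.Build
  {mpoly rat[N]} quot_ring quot_class quot_class_is_monoid_morphism.

Lemma quot_class_eq0 p : quot_class p = 0 <-> I p.
Proof.
rewrite -(raddf0 quot_class) /quot_class; split.
  by move/eqP; rewrite -Quotient.idealrBE subr0 => /asboolP.
by move=> Ip; apply/eqP; rewrite -Quotient.idealrBE subr0; apply/asboolP.
Qed.

Lemma quot_class_surj a : exists p, a = quot_class p.
Proof. by exists (repr a); rewrite /quot_class reprK. Qed.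

Lemma quot_piece0 d : quot_piece d 0.
Proof. by exists 0; rewrite ?rpred0 ?raddf0. Qed.

Lemma quot_pieceB d a b :
  quot_piece d a -> quot_piece d b -> quot_piece d (a - b).
Proof.
by move=> [p hp ->] [q hq ->]; exists (p - q); rewrite ?rpredB ?raddfB.
Qed.

Lemma quot_piece1 : quot_piece 0 1.
Proof. by exists 1; rewrite ?rmorph1 ?dhomog1. Qed.

Lemma quot_pieceM d e a b :
  quot_piece d a -> quot_piece e b -> quot_piece (d + e) (a * b).
Proof.
move=> [p hp ->] [q hq ->].
by exists (p * q); rewrite ?rmorphM //; apply: dhomogM.
Qed.

Lemma quot_piece_span a : exists M (c : nat -> quot_ring),
  (forall d, quot_piece d (c d)) /\ a = \sum_(d < M) c d.
Proof.
have [p ->] := quot_class_surj a.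
exists (msize p), (fun d => quot_class (pihomog mdeg d p)); split.
  by move=> d; exists (pihomog mdeg d p) => //; apply: pihomogP.
by rewrite -raddf_sum -pihomog_partitionE.
Qed.

Lemma quot_piece_direct M (c : nat -> quot_ring) :
  (forall d, quot_piece d (c d)) ->
  \sum_(d < M) c d = 0 -> forall d, (d < M)%N -> c d = 0.
Proof.
move=> /= hc.
have /choice[p hp] : forall d, exists p : {mpoly rat[N]},
  p \is d.-homog /\ c d = quot_class p by move=> d; case: (hc d) => p; exists p.
under eq_bigr => d _ do rewrite (hp d).2.
rewrite -raddf_sum => /quot_class_eq0 Ip d ltdM.
rewrite (hp d).2; apply/quot_class_eq0.
have := hi_homog d Ip; rewrite raddf_sum (bigD1 (Ordinal ltdM)) //=.
rewrite (pihomog_dE (hp d).1) big1 ?addr0 // => e ne_ed.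
by rewrite (pihomog_ne0 _ (hp e).1).
Qed.

Definition quot_graded : gradedRing :=
  GradedRing quot_piece0 quot_pieceB quot_piece1 quot_pieceM
             quot_piece_span quot_piece_direct.

End GradedQuotient.

Section Homogeneity.

Variable N : nat.
Implicit Types (G I J : {mpoly rat[N]} -> Prop).

Lemma gen_ideal_homogeneous G :
  (forall g, G g -> exists e, g \is e.-homog) -> homogeneous (gen_ideal G).
Proof.
move=> hG d p [s [Gs ->]].
have idG := gen_ideal_is_ideal G; have [_ _ GM] := idG.
rewrite raddf_sum big_seq; apply: ideal_sum => //= u us.
have Gu := Gs _ us; have [e he] := hG _ Gu.
rewrite {1}(pihomog_partitionE (leqnn (mmeasure mdeg u.1))) mulr_suml raddf_sum.
apply: ideal_sum => //= i _.
have hi : pihomog mdeg i u.1 * u.2 \is (i + e).-homog.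
  by apply: dhomogM => //; apply: pihomogP.
have [<-|ne] := eqVneq (i + e)%N d; last first.
  by rewrite (pihomog_ne0 ne hi); case: idG.
rewrite pihomog_dE //; apply: GM.
by exists [:: (1, u.2)]; rewrite big_seq1 mul1r; split=> // v /[!inE] /eqP->.
Qed.

Lemma add_ideal_homogeneous I J :
  homogeneous I -> homogeneous J -> homogeneous (add_ideal I J).
Proof.
move=> hI hJ d _ [p [q [Ip Jq ->]]].
by exists (pihomog mdeg d p), (pihomog mdeg d q); rewrite raddfD; split; auto.
Qed.

End Homogeneity.

Definition is_part (k : nat) (la : seq nat) : bool :=
  [&& sorted geq la, 0%N \notin la & sumn la == k].

Record intpart (k : nat) := IntPart {
  part_seq :> seq nat;
  part_seqP : is_part k part_seq
}.

(* The j-th part (j >= 1) of the conjugate partition, padded by zeros.        *)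
Definition conj_part (la : seq nat) (j : nat) : nat := count (leq j) la.

Definition conj_seq (la : seq nat) : seq nat :=
  mkseq (fun j => conj_part la j.+1) (head 0%N la).

Lemma sum_conj_part (la : seq nat) d :
  (\sum_(1 <= i < d.+1) conj_part la i = \sum_(a <- la) minn a d)%N.
Proof.
elim: la => [|a la IHla].
  by rewrite big_nil big1.
rewrite big_cons -IHla /conj_part /= big_split /=; congr addn.
rewrite big_add1 /= big_mkord.
elim: d {IHla} => [|d IHd]; first by rewrite big_ord0 minn0.
by rewrite big_ord_recr /= IHd; case: (ltngtP d a) => // ?; lia.
Qed.

Lemma conj_seqP k (la : intpart k) : is_part k (conj_seq la).
Proof.
case: la => la /= /and3P[s_la la0 /eqP k_la].
have le_head a : a \in la -> (a <= head 0 la)%N.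
  case: la s_la {la0 k_la} => //= b la; rewrite inE => pth /predU1P[->|a_la] //.
  have geq_tr : transitive geq by move=> x y z /= hx hz; apply: leq_trans hx.
  by have /allP/(_ _ a_la) := order_path_min geq_tr pth.
apply/and3P; split.
- apply/(sortedP 0%N) => i; rewrite size_mkseq => lti.
  rewrite !nth_mkseq // ?(ltn_trans _ lti) //=.
  by apply: sub_count => a; apply: leq_trans.
- apply/mapP => -[j]; rewrite mem_iota add0n => /andP[_ ltj] /esym/eqP.
  apply/negP; rewrite -lt0n -has_count.
  by case: la ltj {s_la la0 k_la le_head} => //= b la ->.
rewrite -k_la sumnE /conj_seq /mkseq big_map.
have := sum_conj_part la (head 0%N la); rewrite big_add1 /= /index_iota subn0 => ->.
apply/eqP; rewrite sumnE big_seq [RHS]big_seq; apply: eq_bigr => a /le_head /minn_idPl; exact.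
Qed.

Definition conj (k : nat) (la : intpart k) : intpart k := IntPart (conj_seqP la).

Definition esymS (n : nat) (S : {set 'I_n}) (d : nat) : {mpoly rat[n]} :=
  \sum_(T : {set 'I_n} | (T \subset S) && (#|T| == d)) \prod_(i in T) 'X_i.

(* p^n_m(la) = la'_n + la'_(n-1) + ... + la'_(n-m+1), for m <= n.             *)
Definition pnm (n m : nat) (la : seq nat) : nat :=
  \sum_((n - m).+1 <= j < n.+1) conj_part la j.

(* The condition d > |S| - p is written |S| < d + p, avoiding the truncated   *)
(* subtraction of nat.                                                        *)
Definition I_gen (n : nat) (la : seq nat) (g : {mpoly rat[n]}) : Prop :=
  exists (S : {set 'I_n}) (d : nat),
    [/\ (1 <= d)%N, (#|S| < d + pnm n #|S| la)%N & g = esymS S d].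

Definition I_ideal (n : nat) (la : seq nat) : {mpoly rat[n]} -> Prop :=
  gen_ideal (@I_gen n la).

Lemma esymS_homog n (S : {set 'I_n}) d : esymS S d \is d.-homog.
Proof.
apply: rpred_sum => T /andP[_ /eqP <-].
rewrite -sum1_card; elim/big_rec2: _ => [|i m p _ hp]; first exact: dhomog1.
by apply: dhomogM hp; rewrite dhomogX /= mdeg1.
Qed.

Lemma I_proper n la : ~ @I_ideal n la 1.
Proof.
pose ev0 (p : {mpoly rat[n]}) := p.@[fun=> 0] = 0.
have ev0_ideal : is_ideal ev0.
  split; rewrite /ev0 ?meval0 //.
    by move=> p q hp hq; rewrite mevalD hp hq addr0.
  by move=> a p hp; rewrite mevalM hp mulr0.
suff H g : I_gen la g -> ev0 g.
  by move=> /(gen_idealS ev0_ideal H)/eqP; rewrite meval1 oner_eq0.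
move=> [S [d [d_gt0 _ ->]]]; rewrite /ev0 raddf_sum big1 // => T.
case/andP=> _ /eqP cT; have : (0 < #|T|)%N by rewrite cT.
case/card_gt0P => i iT; rewrite (bigD1 i) //= mevalM mevalXU mul0r //.
Qed.

Lemma I_homog n la : homogeneous (@I_ideal n la).
Proof.
apply: gen_ideal_homogeneous => _ [S [d [_ _ ->]]].
by exists d; apply: esymS_homog.
Qed.

Definition I_hideal (n : nat) (la : seq nat) : homogIdeal n :=
  HomogIdeal (gen_ideal_is_ideal (@I_gen n la)) (@I_proper n la) (@I_homog n la).

Definition R_ring (n : nat) (la : seq nat) : gradedRing :=
  quot_graded (I_hideal n la).

(* The coordinate ring Q[x_{i,j} : i, j] is {mpoly rat[n * n]}, where x_{i,j} *)
(* is the variable of index mxvec_index i j.                                  *)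

Definition xvar (n : nat) (i j : 'I_n) : {mpoly rat[n * n]} :=
  'X_(mxvec_index i j).

Definition mx_eval (n : nat) (p : {mpoly rat[n * n]}) (X : 'M[rat]_n) : rat :=
  p.@[mxvec X 0].

(* The column space of cokermx A is {v | A *m v = 0}, so that its rank is the *)
(* dimension of the kernel of A acting on column vectors.                     *)
Definition rank_variety (n : nat) (mu : seq nat) (X : 'M[rat]_n) : Prop :=
  forall d : nat, (1 <= d <= n)%N ->
    (\sum_(1 <= i < d.+1) conj_part mu i <= \rank (cokermx (X ^+ d)))%N.

Definition vanishing_ideal (n : nat) (V : 'M[rat]_n -> Prop)
    (p : {mpoly rat[n * n]}) : Prop :=
  forall X, V X -> mx_eval p X = 0.

Definition diag_ideal (n : nat) : {mpoly rat[n * n]} -> Prop :=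
  gen_ideal (fun g => exists i j : 'I_n, i != j /\ g = xvar i j).

Definition OT_ideal (n : nat) (mu : seq nat) : {mpoly rat[n * n]} -> Prop :=
  add_ideal (vanishing_ideal (@rank_variety n mu)) (@diag_ideal n).

Lemma vanishing_ideal_is_ideal n V : is_ideal (@vanishing_ideal n V).
Proof.
split=> [X _|p q hp hq X VX|a p hp X VX]; rewrite /mx_eval.
- exact: meval0.
- by rewrite mevalD -/(mx_eval p X) -/(mx_eval q X) hp ?hq ?addr0.
by rewrite mevalM -/(mx_eval p X) hp ?mulr0.
Qed.

Lemma expmxZ n (c : rat) (X : 'M_n) d : (c *: X) ^+ d = c ^+ d *: X ^+ d.
Proof.
elim: d => [|d IHd]; first by rewrite !expr0 scale1r.
by rewrite !exprS IHd -!mulmxE -scalemxAl -scalemxAr scalerA.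
Qed.

Lemma rank_varietyZ n mu (c : rat) (X : 'M_n) :
  rank_variety mu X -> rank_variety mu (c *: X).
Proof.
move=> hX d hd; apply: leq_trans (hX d hd) _.
by rewrite !mxrank_coker leq_sub2l // expmxZ mxrank_scale.
Qed.

Lemma mx_eval_homogZ n (c : rat) (X : 'M_n) d (p : {mpoly rat[n * n]}) :
  p \is d.-homog -> mx_eval p (c *: X) = c ^+ d * mx_eval p X.
Proof.
move=> /dhomogP hp; rewrite /mx_eval !mevalE mulr_sumr big_seq [RHS]big_seq.
apply: eq_bigr => m /hp <-; rewrite mulrCA /=; congr (_ * _).
rewrite mdegE -prodrXr -big_split /=; apply: eq_bigr => i _.
by rewrite linearZ /= mxE exprMn.
Qed.

Lemma vanishing_ideal_homogeneous n (V : 'M[rat]_n -> Prop) :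
  (forall c X, V X -> V (c *: X)) -> homogeneous (vanishing_ideal V).
Proof.
move=> VZ d p hp X VX.
pose P : {poly rat} := \poly_(e < msize p) mx_eval (pihomog mdeg e p) X.
have P0 : P = 0.
  apply/eqP/negPn/negP => nzP.
  pose rs : seq rat := [seq i%:R | i <- iota 0 (size P)].
  have /(max_poly_roots nzP) : all (root P) rs.
    apply/allP => _ /mapP[i _ ->]; apply/eqP; rewrite horner_poly.
    rewrite -[RHS](hp _ (VZ i%:R _ VX)).
    rewrite [in RHS](pihomog_partitionE (leqnn (mmeasure mdeg p))).
    rewrite [in RHS]/mx_eval raddf_sum.
    apply: eq_bigr => e _; rewrite mulrC -/(mx_eval _ _) -mx_eval_homogZ //.
    exact: pihomogP.
  rewrite size_map size_iota ltnn => /(_ _)/notF; apply.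
  rewrite map_inj_uniq ?iota_uniq // => i j.
  by move/eqP; rewrite Num.Theory.eqr_nat => /eqP.
have := congr1 (fun Q : {poly rat} => Q`_d) P0; rewrite coef0 coef_poly.
case: ltnP => // le_pd _.
rewrite (_ : pihomog mdeg d p = 0); first exact: meval0.
rewrite pihomogE big_seq_cond big1 // => m /andP[/msize_mdeg_lt lt_m /eqP md].
by move: lt_m; rewrite md ltnNge le_pd.
Qed.

Lemma OT_is_ideal n mu : is_ideal (@OT_ideal n mu).
Proof.
exact: add_ideal_is_ideal (vanishing_ideal_is_ideal _) (gen_ideal_is_ideal _).
Qed.

Lemma OT_homog n mu : homogeneous (@OT_ideal n mu).
Proof.
apply: add_ideal_homogeneous.
  by apply: vanishing_ideal_homogeneous => c X; apply: rank_varietyZ.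
apply: gen_ideal_homogeneous => _ [i [j [_ ->]]].
by exists 1%N; rewrite dhomogX /= mdeg1.
Qed.

Lemma rank_variety0 n k (mu : intpart k) : (k <= n)%N ->
  rank_variety mu (0 : 'M[rat]_n).
Proof.
move=> le_kn d /andP[d_gt0 _].
rewrite expr0n gtn_eqF //= mulr0n mxrank_coker mxrank0 subn0.
apply: leq_trans le_kn; rewrite sum_conj_part.
have /and3P[_ _ /eqP {2}<-] := part_seqP mu.
by rewrite sumnE; apply: leq_sum => a _; apply: geq_minl.
Qed.

Lemma OT_proper n k (mu : intpart k) : (k <= n)%N -> ~ @OT_ideal n mu 1.
Proof.
move=> le_kn [p [q [hp hq]]] /(congr1 (fun r => mx_eval r 0)).
rewrite /mx_eval meval1 mevalD -/(mx_eval p 0) hp; last exact: rank_variety0.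
rewrite add0r; suff -> : q.@[mxvec 0 0] = 0 by move/eqP; rewrite oner_eq0.
pose Z (X : 'M[rat]_n) := X = 0.
apply: (gen_idealS (vanishing_ideal_is_ideal Z) _ hq) => //.
by move=> _ [i [j [_ ->]]] _ ->; rewrite /mx_eval mevalXU mxvecE mxE.
Qed.

Definition OT_hideal (n k : nat) (hkn : (k <= n)%N) (mu : intpart k) :
    homogIdeal (n * n) :=
  HomogIdeal (@OT_is_ideal n mu) (OT_proper (mu := mu) hkn) (@OT_homog n mu).

(* Q[O_{n,mu} :&: t]; hkn makes the ideal proper (0 lies in the rank variety), *)
(* as needed for the quotient to be a nonzero ring.                           *)
Definition OT_ring (n k : nat) (hkn : (k <= n)%N) (mu : intpart k) : gradedRing :=
  quot_graded (OT_hideal hkn mu).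

(* Main.v *)
From HB Require Import structures.
Require Import Defs.
From mathcomp Require Import all_boot all_order all_algebra.
From mathcomp Require Import boolp perm mpoly zify ring lra.

(** Restriction to the diagonal matrices identifies Q[O :&: t], where O is the
    rank variety of the conjugate of la (the X with dim ker X^d at least the sum
    of the d largest parts of la, for all d), with Q[x_1, .., x_n] / K, where K
    is the ideal of all restrictions p|t of polynomials p vanishing on O.  The
    theorem therefore says that K is the ideal I generated by the e_d(S) with
    |S| < d + p_|S|(la); this is [OT_idealE].

    I is contained in K: let D be the coordinate projection onto S.  Then e_d(S)
    is the restriction to diagonal matrices of a coefficient of the characteristic
    polynomial of - D X D ([diag_res_minors]).  If X is in O then the powers of
    D X D have small rank ([rank_compress]), and the characteristic polynomial of
    any Y is divisible by the variable to the power dim ker Y^e, for every e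
    ([char_poly_coef0]), so this coefficient vanishes on O ([minors_vanish]).

    K is contained in I: no generators of the vanishing ideal of O are needed.
    Place the columns of la as disjoint blocks of variables, and number the
    variables of each block 0, 1, 2, ..  This filling defines a linear functional
    on Q[x_1, .., x_n]: antisymmetrise over each block and read off the
    coefficient whose exponents are the numbers of the variables, the exponents
    of the variables outside the blocks being arbitrary but fixed.  Its
    [alt_ideal] is the largest ideal on which it vanishes.  Two facts are needed.

    - If p vanishes on O, then every functional kills p|t ([altf_diag_res]).
      Let M be the matrix with diagonal x and an entry -1 from each variable of a
      block to the next one.  Modulo the elementary symmetric polynomials of the
      blocks, which belong to [alt_ideal], M agrees with a matrix that is
      nilpotent and cyclic on each block, hence lies in O at each rational point;
      so the functional kills p(M).  By homogeneity it takes the same value on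
      p(M) and on p|t, because the constant entries of M only contribute terms
      of too low degree.

    - The intersection of all these [alt_ideal]s is contained in I
      ([init_ideal_of_alt]).  This goes by induction on the number m of variables
      in use, filtering by the powers of the last variable x.  If x^i h lies in
      all the ideals, then h modulo x lies in the corresponding ideals for m - 1
      variables and for the partition obtained from la by removing a cell from a
      row of index i (if there is such a row): each filling is extended by
      adding x to the shortened column, or else with exponent i outside the
      columns.  Conversely, x^i times the smaller ideal lies in I + (x^(i+1))
      ([init_ideal_step]).

    In this induction a partition enters only through its column heights
    ([conj_part]) and the sums over its parts a of the truncated differences
    a - t ([tailsum]); both make sense for an unsorted list of parts, so the parts
    need not be sorted again when a cell is removed. *)

Set Implicit Arguments.
Unset Strict Implicit.
Unset Printing Implicit Defensive.

Import GRing.Theory.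
Local Open Scope ring_scope.

(** * Alternating functionals attached to fillings *)

(** A placement of columns of heights b 1, b 2, .. in {0, .., n-1}: [col i] is
    the column containing i, or 0 if i belongs to no column, and [dl] restricts to
    a bijection from column c onto {0, .., b c - 1}.  On the elements outside the
    columns [dl] is arbitrary. *)
Record filling (n : nat) (b : nat -> nat) (col dl : 'I_n -> nat) : Prop :=
  Filling {
    filling_lt : forall i, col i != 0%N -> (dl i < b (col i))%N;
    filling_inj : forall i j,
      col i != 0%N -> col i = col j -> dl i = dl j -> i = j;
    filling_surj : forall c a, c != 0%N -> (a < b c)%N ->
      exists2 i, col i = c & dl i = a
  }.

Definition block (n : nat) (col : 'I_n -> nat) (c : nat) : {set 'I_n} :=
  [set i | col i == c].

Lemma in_block n (col : 'I_n -> nat) c i : (i \in block col c) = (col i == c).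
Proof. by rewrite inE. Qed.

Lemma card_block n b (col dl : 'I_n -> nat) c :
  filling b col dl -> c != 0%N -> #|block col c| = b c.
Proof.
move=> [flt finj fsurj] c0.
have uD : uniq [seq dl i | i <- enum (block col c)].
  rewrite map_inj_in_uniq ?enum_uniq // => i j.
  rewrite !mem_enum !in_block => /eqP ci /eqP cj; apply: finj; first by rewrite ci.
  by rewrite ci cj.
rewrite cardE -(size_map dl) -(size_iota 0 (b c)).
apply/perm_size/uniq_perm; rewrite ?iota_uniq // => a.
rewrite mem_iota add0n /=; apply/mapP/idP => [[i]|lt_a].
  by rewrite mem_enum in_block => /eqP ci ->; have := flt i; rewrite ci; apply.
by have [i ci <-] := fsurj c a c0 lt_a; exists i; rewrite // mem_enum in_block ci.
Qed.

(** Distinct numbers smaller than their number are 0, 1, 2, .. in some order. *)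
Lemma sum_inj_lt_card n (B : {set 'I_n}) (f : 'I_n -> nat) :
  {in B &, injective f} -> (forall i, i \in B -> (f i < #|B|)%N) ->
  (\sum_(i in B) f i = \sum_(v < #|B|) v)%N.
Proof.
move=> finj flt.
have uf : uniq [seq f i | i <- enum B].
  rewrite map_inj_in_uniq ?enum_uniq // => i j.
  by rewrite !mem_enum; apply: finj.
have sub : {subset [seq f i | i <- enum B] <= iota 0 #|B|}.
  by move=> a /mapP[i]; rewrite mem_enum mem_iota add0n => /flt lti ->.
have /(uniq_min_size uf sub)[_ eqm] :
    (size (iota 0 #|B|) <= size [seq f i | i <- enum B])%N.
  by rewrite size_iota size_map -cardE.
rewrite -big_enum -(big_map f xpredT id) -(big_mkord xpredT id) /index_iota subn0.
by apply/perm_big/uniq_perm; rewrite ?iota_uniq.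
Qed.

Section Alternating.

Variables (n : nat) (col dl : 'I_n -> nat).
Implicit Types (f g q : {mpoly rat[n]}) (s : 'S_n).

(** The permutations preserving each column and fixing the other elements. *)
Definition colperm : {set 'S_n} :=
  [set s : 'S_n |
    [forall i, (col (s i) == col i) && ((col i == 0%N) ==> (s i == i))]].

Lemma colpermP s :
  reflect (forall i, col (s i) = col i /\ (col i = 0%N -> s i = i))
          (s \in colperm).
Proof.
rewrite inE; apply: (iffP forallP) => H i; have := H i.
  by case/andP=> /eqP -> /implyP Hi; split=> // /eqP /Hi /eqP.
by case=> -> Hi; rewrite eqxx; apply/implyP => /eqP /Hi ->.
Qed.

Definition permexp s : 'X_{1..n} := [multinom dl (s i) | i < n].

(** The alternating sum of the coefficients of f at the monomials with exponents
    [dl \o s]; equivalently, the coefficient at exponents [dl] of the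
    antisymmetrisation of f over the columns. *)
Definition altf f : rat := \sum_(s in colperm) (-1) ^+ s * f@_(permexp s).

Lemma altf_is_zmod_morphism : zmod_morphism altf.
Proof.
move=> f g; rewrite /altf -sumrB; apply: eq_bigr => s _.
by rewrite mcoeffB mulrBr.
Qed.

HB.instance Definition _ :=
  GRing.isZmodMorphism.Build {mpoly rat[n]} rat altf altf_is_zmod_morphism.

Lemma altfZ c f : altf (c *: f) = c * altf f.
Proof.
rewrite /altf mulr_sumr; apply: eq_bigr => s _.
by rewrite mcoeffZ mulrCA.
Qed.

Lemma altf_monomials f g :
  (forall m, altf (f * 'X_[m]) = 0) -> altf (f * g) = 0.
Proof.
move=> H; rewrite [g]mpolyE mulr_sumr raddf_sum big1 // => m _.
by rewrite -scalerAr /= altfZ H mulr0.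
Qed.

(** The largest ideal on which [altf] vanishes. *)
Definition alt_ideal f : Prop := forall q, altf (f * q) = 0.

Lemma alt_ideal_is_ideal : is_ideal alt_ideal.
Proof.
split=> [q|f g Jf Jg q|a f Jf q]; first by rewrite mul0r raddf0.
  by rewrite mulrDl raddfD /= Jf Jg addr0.
by rewrite (mulrC a) -mulrA Jf.
Qed.

Lemma alt_ideal_altf f : alt_ideal f -> altf f = 0.
Proof. by move=> /(_ 1); rewrite mulr1. Qed.

(** Composing with a transposition inside a column changes the sign of [altf]. *)
Lemma altf_swap i j f : i != j -> col i = col j -> col i != 0%N ->
  msym (tperm i j) f = f -> altf f = 0.
Proof.
move=> neq cij c0 fE; suff H : altf f = - altf f by lra.
rewrite {1}/altf -sumrN (reindex_inj (mulgI (tperm i j))) /=.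
apply: eq_big => s.
  apply/colpermP/colpermP => H k; last first.
    rewrite permM; case: tpermP => [->|->|_ _]; last exact: H.
      by rewrite (H j).1 cij; split=> // /eqP; rewrite -cij (negPf c0).
    by rewrite (H i).1 cij; split=> // /eqP; rewrite -cij (negPf c0).
  have := H (tperm i j k); rewrite permM tpermK; case: tpermP => [->|->|_ _] //.
    by rewrite cij => -[-> _]; split=> // /eqP; rewrite -cij (negPf c0).
  by rewrite cij => -[-> _]; split=> // /eqP; rewrite -cij (negPf c0).
move=> _; rewrite odd_permM odd_tperm neq signr_addb expr1 !mulN1r mulNr.
congr (- (_ * _)); rewrite -{1}fE mcoeff_sym; congr mcoeff.
by apply/mnmP => k; rewrite !mnmE permM tpermK.
Qed.

End Alternating.

(** The exponents of the squarefree monomial on T. *)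
Definition setexp n (T : {set 'I_n}) : 'X_{1..n} :=
  [multinom nat_of_bool (i \in T) | i < n].

Lemma prod_setexp n (T : {set 'I_n}) :
  \prod_(i in T) 'X_i = 'X_[setexp T] :> {mpoly rat[n]}.
Proof.
rewrite mprodXE; congr mpolyX; apply/mnmP => i; rewrite mnm_sumE mnmE.
under eq_bigr => j _ do rewrite mnm1E.
case iT: (i \in T); last first.
  by rewrite big1 // => j jT; case: eqVneq jT iT => // -> ->.
rewrite (bigD1 i) //= eqxx big1 // => j /andP[_ ne]; by rewrite (negPf ne).
Qed.

Lemma msym_esymS n (s : 'S_n) (S : {set 'I_n}) d :
  msym s (esymS S d) = esymS [set s i | i in S] d.
Proof.
rewrite /esymS raddf_sum /=.
rewrite [RHS](reindex_inj (imset_inj (@perm_inj _ s))) /=.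
apply: eq_big => T.
  rewrite (card_imset _ (@perm_inj _ s)); congr (_ && _); apply/idP/idP.
    by move=> /subsetP H; apply/subsetP => x /imsetP[y /H yS ->]; apply: imset_f.
  move=> /subsetP H; apply/subsetP => x /(imset_f s)/H /imsetP[y yS].
  by move/perm_inj ->.
move=> _; rewrite rmorph_prod /= big_imset /=; last by move=> ? ? _ _; apply: perm_inj.
apply: eq_bigr => i _; rewrite /msym mmapX mmap1U //.
Qed.

(** Let m be a monomial.  If two variables of the column have the same exponent
    in m, then e_d times m is symmetric in them.  Otherwise the exponents of m in
    the column are distinct, so their sum is already at least that of
    0, .., b c - 1, and the positive degree of e_d makes it too large. *)
Lemma alt_ideal_esymS_block n b (col dl : 'I_n -> nat) c d :
  filling b col dl -> c != 0%N -> (0 < d)%N ->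
  alt_ideal col dl (esymS (block col c) d).
Proof.
move=> fil c0 d0 q; apply: altf_monomials => m; set B := block col c.
case: (boolP [exists i in B, [exists j in B, (i != j) && (m i == m j)]]).
  case/existsP=> i /andP[iB] /existsP[j /andP[jB /andP[neq /eqP mij]]].
  move: (iB) (jB); rewrite !in_block => /eqP ci /eqP cj.
  apply: (@altf_swap _ _ _ i j) => //; rewrite ?ci ?cj //.
  rewrite msymM msym_esymS msymX tpermV; congr (_ * _); last first.
    by congr mpolyX; apply/mnmP => k; rewrite mnmE; case: tpermP => [->|->|].
  congr esymS; apply/eqP; rewrite eqEcard (card_imset _ (@perm_inj _ _)) leqnn andbT.
  by apply/subsetP => x /imsetP[y yB ->]; case: tpermP => [_|_|].
rewrite negb_exists_in => /forall_inP Hinj.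
have minj : {in B &, injective m}.
  move=> i j iB jB mij; apply/eqP; apply: contraT => neq.
  have := Hinj i iB; rewrite negb_exists_in => /forall_inP/(_ j jB).
  by rewrite neq mij eqxx.
rewrite /esymS mulr_suml raddf_sum big1 // => T /andP[TB /eqP cT] /=.
rewrite prod_setexp -mpolyXD /altf big1 // => s /colpermP sP.
rewrite mcoeffX; case: eqP => [E|]; last by rewrite mulr0.
have Bc : #|B| = b c by apply: card_block fil c0.
have Ei i : dl (s i) = ((i \in T) + m i)%N.
  by have := congr1 (fun u : 'X_{1..n} => u i) E; rewrite !mnmE.
have dlt i : i \in B -> (dl (s i) < #|B|)%N.
  rewrite in_block Bc => /eqP ci.
  have := filling_lt fil (i := s i); rewrite (sP i).1 ci; exact.
have : (\sum_(i in B) dl (s i) = \sum_(i in B) m i)%N.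
  rewrite (sum_inj_lt_card (f := m)) //; last first.
    by move=> i iB; apply: leq_ltn_trans (dlt i iB); rewrite Ei leq_addl.
  apply: sum_inj_lt_card => //.
  move=> i j; rewrite !in_block => /eqP ci /eqP cj Eij.
  by apply: (@perm_inj _ s); apply: (filling_inj fil); rewrite ?(sP _).1 ?ci ?cj.
under eq_bigr => i _ do rewrite Ei.
rewrite big_split /= => /eqP; rewrite -{2}[(\sum_(i in B) m i)%N]add0n eqn_add2r.
rewrite -[d]cT in d0; move: d0; rewrite -sum1_card [X in (0 < X)%N -> _]big_mkcond.
rewrite [X in X == _]big_mkcond /=.
rewrite [X in X == _](eq_bigr (fun i => if i \in T then 1 else 0)%N) => [|i _].
  by rewrite lt0n => /negP H E0; case: (H E0).
by case: ifP => [_|iB]; case: (boolP (i \in T)) => // /(subsetP TB); rewrite iB.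
Qed.

(** Here [col'], [dl'] is obtained from [col], [dl] by taking x, the last cell of
    its column or an element of no column, out of use.  Multiplication by the
    power of x prescribed by [dl] selects the permutations that fix x. *)
Lemma altf_add_cell n (col dl col' dl' : 'I_n -> nat) (x : 'I_n) f :
  (forall i, i != x -> col i = col' i /\ dl i = dl' i) ->
  col' x = 0%N -> dl' x = 0%N ->
  (col x != 0%N -> forall i, i != x -> col i = col x -> (dl i < dl x)%N) ->
  altf col dl ('X_x ^+ dl x * f) = altf col' dl' f.
Proof.
move=> eqo c0 d0 maxx; rewrite /altf.
rewrite (bigID (fun s : 'S_n => s x == x)) /= [X in _ + X]big1 ?addr0; last first.
  move=> s /andP[/colpermP sP sx].
  case: (eqVneq (col x) 0%N) => [cx|cx]; first by rewrite (sP x).2 // eqxx in sx.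
  rewrite [f]mpolyE mulr_sumr raddf_sum big1 ?mulr0 // => m _ /=.
  rewrite -scalerAr mcoeffZ mpolyXn -mpolyXD mcoeffX.
  case: eqP => [E|]; last by rewrite mulr0.
  have := congr1 (fun u : 'X_{1..n} => u x) E.
  rewrite mnmDE mulmnE mnm1E eqxx mnmE.
  have := maxx cx _ sx (sP x).1; lia.
apply: eq_big => s.
  apply/andP/colpermP => [[/colpermP sP /eqP sx] i|sP].
    case: (eqVneq i x) => [->|nei]; first by rewrite sx c0.
    have nes : s i != x by rewrite -[X in _ != X]sx (inj_eq perm_inj).
    by rewrite -!(eqo _ _).1 //; case: (sP i) => ? ?; split.
  have sx : s x = x by apply: (sP x).2.
  split; last by rewrite sx.
  apply/colpermP => i; case: (eqVneq i x) => [->|nei]; first by rewrite sx.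
  have nes : s i != x by rewrite -[X in _ != X]sx (inj_eq perm_inj).
  by rewrite !(eqo _ _).1.
move=> /andP[_ /eqP sx]; congr (_ * _).
rewrite mulrC mpolyXn; have <- : (U_(x) *+ dl x + permexp dl' s = permexp dl s)%MM.
  apply/mnmP => i; rewrite mnmDE mulmnE mnm1E !mnmE; case: (eqVneq x i) => [<-|nei].
    by rewrite sx d0; lia.
  have nes : s i != x by rewrite -[X in _ != X]sx (inj_eq perm_inj) eq_sym.
  by rewrite (eqo _ nes).2.
exact: mcoeffMX.
Qed.

(** * Ideals and elementary symmetric polynomials *)

Section IdealFacts.
Variables (R : comNzRingType) (I : R -> Prop).
Hypothesis idI : is_ideal I.

Lemma ideal0 : I 0. Proof. by case: idI. Qed.
Lemma idealD p q : I p -> I q -> I (p + q). Proof. by case: idI => ? H ?; apply: H. Qed.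
Lemma idealM (a p : R) : I p -> I (a * p). Proof. by case: idI => ? ? H; apply: H. Qed.
Lemma idealN p : I p -> I (- p). Proof. by rewrite -mulN1r; apply: idealM. Qed.
Lemma idealB p q : I p -> I q -> I (p - q).
Proof. by move=> Ip Iq; apply/idealD/idealN. Qed.

(** The polynomials whose coefficients all lie in I. *)
Definition coef_ideal (F : {poly R}) : Prop := forall k, I F`_k.

Lemma coef_ideal_is_ideal : is_ideal coef_ideal.
Proof.
split=> [k|F G IF IG k|A F IF k]; first by rewrite coef0; apply: ideal0.
  by rewrite coefD; apply: idealD.
by rewrite coefM; apply: ideal_sum => // j _; apply: idealM.
Qed.

End IdealFacts.

Lemma gen_ideal_mem (R : comNzRingType) (G : R -> Prop) g : G g -> gen_ideal G g.
Proof.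
move=> Gg; exists [:: (1, g)]; rewrite big_seq1 mul1r; split=> // u.
by rewrite inE => /eqP ->.
Qed.

Lemma prodD_subsets (A : comNzRingType) (I : finType) (S : {set I})
    (u v : I -> A) :
  \prod_(i in S) (u i + v i) =
  \sum_(T : {set I} | T \subset S)
     (\prod_(i in T) u i) * \prod_(i in S :\: T) v i.
Proof.
rewrite big_mkcond /=.
pose F i := if i \in S then u i else 0; pose G i := if i \in S then v i else 1.
rewrite (eq_bigr (fun i => F i + G i)) => [|i _]; last first.
  by rewrite /F /G; case: ifP; rewrite ?add0r.
rewrite bigA_distr (bigID (fun T : {set I} => T \subset S)) /= [X in _ + X]big1 ?addr0.
  apply: eq_bigr => T TS.
  rewrite [X in X * _]big_mkcond [X in _ * X]big_mkcond -big_split /=.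
  apply: eq_bigr => i _; rewrite /F /G inE.
  by case: (boolP (i \in T)) => [/(subsetP TS) ->|_] /=; rewrite ?mulr1 ?mul1r.
move=> T /subsetPn[i iT iS].
by rewrite (bigD1 i) //= iT /F (negPf iS) mul0r.
Qed.

Section Esym.
Variable n : nat.
Implicit Types (S T : {set 'I_n}).

(** The generating function of the e_d(S). *)
Definition esym_gf S : {poly {mpoly rat[n]}} := \prod_(i in S) ('X_i *: 'X + 1).

Lemma coef_esym_gf S d : (esym_gf S)`_d = esymS S d.
Proof.
rewrite /esym_gf prodD_subsets coef_sum /esymS big_mkcondr /=.
apply: eq_bigr => T _; rewrite [X in _ * X]big1 // mulr1.
under eq_bigr => i _ do rewrite -mul_polyC.
rewrite big_split /= prodr_const -rmorph_prod /= coefCM coefXn eq_sym.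
by case: eqP; rewrite ?mulr1 ?mulr0.
Qed.

Lemma esymS0 S : esymS S 0 = 1.
Proof.
rewrite -coef_esym_gf -horner_coef0 /esym_gf horner_prod big1 // => i _.
by rewrite !hornerE.
Qed.

Lemma esymS_U1 S x d : x \notin S ->
  esymS (x |: S) d.+1 = esymS S d.+1 + 'X_x * esymS S d.
Proof.
move=> xS; rewrite -!coef_esym_gf /esym_gf big_setU1 //= mulrDl mul1r coefD addrC.
by rewrite -mul_polyC -mulrA coefCM coefXM.
Qed.

Lemma esymS_gt S d : (#|S| < d)%N -> esymS S d = 0.
Proof.
move=> lt; rewrite /esymS big1 // => T /andP[TS /eqP cT].
by have := subset_leq_card TS; rewrite cT leqNgt lt.
Qed.

End Esym.

(** * The ideals of the first m variables *)

(** For a partition, this is the sum of all its columns except the first t;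
    it makes sense for an unsorted list of parts. *)
Definition tailsum (la : seq nat) (t : nat) : nat := \sum_(a <- la) (a - t).

Lemma tailsumS la t : (tailsum la t = tailsum la t.+1 + conj_part la t.+1)%N.
Proof.
rewrite /tailsum /conj_part; elim: la => [|a la IH]; first by rewrite !big_nil.
by rewrite !big_cons /= IH; lia.
Qed.

Lemma leq_conj_part la : {homo conj_part la : i j / (i <= j)%N >-> (j <= i)%N}.
Proof. by move=> i j le_ij; apply: sub_count => a; apply: leq_trans. Qed.

(** c is the i-th largest part of la, counting from 0, or 0 if la has at most i
    nonzero parts. *)
Lemma exists_cut la i : exists2 c,
  (forall t, (c <= t)%N -> (conj_part la t.+1 <= i)%N) &
  (c != 0%N -> c \in la /\ (i < conj_part la c)%N).
Proof.
have ex : exists t, (conj_part la t.+1 <= i)%N.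
  exists (sumn la); rewrite /conj_part (eq_in_count (a2 := pred0)) ?count_pred0 //.
  move=> a /= al; apply/negbTE; rewrite -leqNgt sumnE (big_rem a) //= leq_addr //.
have [c hc minc] := ex_minnP ex; exists c.
  by move=> t le_ct; apply: leq_trans (leq_conj_part _ _) hc.
case: c hc minc => // c hc minc _.
have lt : (i < conj_part la c.+1)%N.
  by rewrite ltnNge; apply/negP => /minc; rewrite ltnn.
split=> //; rewrite -has_pred1 has_count.
have : (conj_part la c.+1 = conj_part la c.+2 + count_mem c.+1 la)%N.
  rewrite /conj_part; elim: (la) => //= a l ->; lia.
by move: lt hc; rewrite -/(conj_part la c.+2); lia.
Qed.

(** One part c is replaced by c - 1, at the head of the list; nothing changes if
    c = 0. *)
Definition dec_part (c : nat) (la : seq nat) : seq nat :=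
  if c == 0%N then la else c.-1 :: rem c la.

Lemma tailsum_dec c la t : (c != 0%N -> c \in la) ->
  (tailsum la t = tailsum (dec_part c la) t + (t < c))%N.
Proof.
rewrite /dec_part; case: eqP => [-> _|/eqP c0 /(_ isT) cla]; first by rewrite addn0.
rewrite /tailsum (big_rem c) //= big_cons; lia.
Qed.

Lemma conj_part_dec c la j : (c != 0%N -> c \in la) -> j != 0%N ->
  (conj_part la j = conj_part (dec_part c la) j + (j == c))%N.
Proof.
rewrite /dec_part; case: eqP => [-> _ /negPf ->|/eqP c0 /(_ isT) cla j0].
  by rewrite addn0.
have /seq.permP/(_ (leq j)) := perm_to_rem cla; rewrite /conj_part => -> /=.
lia.
Qed.

Section InitIdeal.
Variable n : nat.

(** The generators of I for the first m variables, together with the other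
    variables.  The case d = 0 is not excluded: it makes the ideal trivial when la
    has more than m cells, so that no bound on the size of la is needed. *)
Definition init_gen (m : nat) (la : seq nat) (g : {mpoly rat[n]}) : Prop :=
  (exists (S : {set 'I_n}) d,
    [/\ forall i, i \in S -> (i < m)%N,
        (#|S| < d + tailsum la (m - #|S|))%N & g = esymS S d]) \/
  (exists2 j : 'I_n, (m <= j)%N & g = 'X_j).

Definition init_ideal m la := gen_ideal (init_gen m la).

Lemma init_ideal_is_ideal m la : is_ideal (init_ideal m la).
Proof. exact: gen_ideal_is_ideal. Qed.

Lemma init_ideal_homogeneous m la : homogeneous (init_ideal m la).
Proof.
apply: gen_ideal_homogeneous => g [[S [d [_ _ ->]]]|[j _ ->]].
  by exists d; apply: esymS_homog.
by exists 1%N; rewrite dhomogX /= mdeg1.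
Qed.

Lemma card_init_leq m (S : {set 'I_n}) :
  (forall i, i \in S -> (i < m)%N) -> (#|S| <= m)%N.
Proof.
move=> Sm; rewrite cardE -(size_map val) -[leqRHS](size_iota 0).
apply: uniq_leq_size; first by rewrite map_inj_uniq ?enum_uniq //; apply: val_inj.
by move=> a /mapP[i]; rewrite mem_enum mem_iota add0n => /Sm /= lt ->.
Qed.

(** x is the last of the first m + 1 variables.  Let e_d(S) be a generator for m
    variables, put t = m - |S| and let S' be S with x added, so that
    e_d(S') = e_d(S) + x e_(d-1)(S).  If c > t, then e_d(S') is a generator for
    m + 1 variables.  If c <= t, then all e_(j+1)(S') with j >= d are; modulo
    these, x^u e_d(S) equals e_(d+u)(S) up to sign, which is a generator when u is
    the number of parts larger than t; and u <= i. *)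
Lemma init_ideal_step m la c i (x : 'I_n) g : val x = m ->
  (c != 0%N -> c \in la) ->
  (forall t, (c <= t)%N -> (conj_part la t.+1 <= i)%N) ->
  init_ideal m (dec_part c la) g ->
  exists h, init_ideal m.+1 la ('X_x ^+ i * g - 'X_x ^+ i.+1 * h).
Proof.
move=> xm cla hc.
have idI := init_ideal_is_ideal m.+1 la; set I := init_ideal m.+1 la in idI *.
apply: (gen_idealS (I := fun g => exists h, I ('X_x ^+ i * g - 'X_x ^+ i.+1 * h))).
  split.
  - by exists 0; rewrite !mulr0 subr0; apply: ideal0.
  - move=> p q [h Ih] [h' Ih']; exists (h + h'); rewrite !mulrDr opprD addrACA.
    exact: idealD.
  - move=> a p [h Ih]; exists (a * h); rewrite !(mulrCA _ a) -mulrBr.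
    exact: idealM.
move=> {}g [[S [d [Sm lt ->]]]|[j mj ->]]; last first.
  have [->|nej] := eqVneq j x.
    by exists 1; rewrite mulr1 -exprSr subrr; apply: ideal0.
  exists 0; rewrite mulr0 subr0; apply: idealM => //.
  apply: gen_ideal_mem; right; exists j => //.
  by rewrite ltn_neqAle mj andbT -xm eq_sym; apply: contra nej => /eqP/val_inj ->.
have xS : x \notin S by apply/negP => /Sm; rewrite xm ltnn.
have leS := card_init_leq Sm.
have F1 e : (#|S| < e + tailsum la (m - #|S|).+1)%N -> I (esymS S e).
  move=> lte; apply: gen_ideal_mem; left; exists S, e; split=> //.
    by move=> k /Sm /ltnW.
  by rewrite subSn.
have F2 e : (#|S|.+1 < e + tailsum la (m - #|S|))%N -> I (esymS (x |: S) e).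
  move=> lte; apply: gen_ideal_mem; left; exists (x |: S), e.
  rewrite cardsU1 xS add1n subSS; split=> // k /setU1P[->|/Sm /ltnW //].
  by rewrite xm.
have tE := tailsum_dec (m - #|S|) cla.
case: (ltnP (m - #|S|) c) tE => hct tE.
  have {}F2 : I (esymS (x |: S) d) by apply: F2; rewrite tE; lia.
  case: d F2 {lt} => [|d] F2.
    exists 0; rewrite mulr0 subr0; apply: idealM => //.
    by move: F2; rewrite !esymS0.
  exists (- esymS S d); rewrite mulrN opprK exprSr -mulrA -mulrDr -esymS_U1 //.
  exact: idealM.
exists 0; rewrite mulr0 subr0.
have [u le_ui Iu] : exists2 u, (u <= i)%N & I (esymS S (d + u)).
  exists (conj_part la (m - #|S|).+1); first exact: hc.
  by apply: F1; move: lt; rewrite -(addn0 (tailsum _ _)) -tE tailsumS; lia.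
have {}F2 e : (d <= e)%N -> I (esymS (x |: S) e.+1) by move=> le; apply: F2; lia.
rewrite -(subnK le_ui) exprD -mulrA; apply: idealM => //.
elim: u d {lt le_ui} Iu F2 => [|u IHu] d Iu F2; first by rewrite mul1r -[d]addn0.
have : I ('X_x ^+ u * esymS S d.+1).
  by apply: IHu => [|e /ltnW /F2 //]; rewrite addSnnS.
move=> Iu1; rewrite exprSr -mulrA.
have -> : 'X_x * esymS S d = esymS (x |: S) d.+1 - esymS S d.+1.
  by rewrite esymS_U1 // addrAC subrr add0r.
by rewrite mulrBr; apply: idealB => //; apply: idealM => //; apply: F2.
Qed.

End InitIdeal.

(** * The generators lie in the alternating ideals *)

(** The elements i >= m are outside the columns and have exponent 0. *)
Definition inactive n (col dl : 'I_n -> nat) (m : nat) : Prop :=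
  forall i : 'I_n, (m <= i)%N -> col i = 0%N /\ dl i = 0%N.

Section Kill.
Variables (n m : nat) (la : seq nat) (col dl : 'I_n -> nat).
Hypothesis fil : filling (conj_part la) col dl.
Hypothesis ina : inactive col dl m.
Local Notation J := (alt_ideal col dl).
Let idJ : is_ideal J := alt_ideal_is_ideal col dl.
Let idJy : is_ideal (coef_ideal J) := coef_ideal_is_ideal idJ.

Lemma col_bound i : (col i < (sumn la).+1)%N.
Proof.
rewrite ltnS; case: (eqVneq (col i) 0%N) => [->//|c0].
have := leq_ltn_trans (leq0n _) (filling_lt fil c0).
rewrite -has_count => /hasP[a ala le_a]; apply: leq_trans le_a _.
by rewrite sumnE (big_rem a) //= leq_addr.
Qed.

(** The union of the columns contained in S. *)
Definition full (S : {set 'I_n}) : {set 'I_n} :=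
  [set i | (col i != 0%N) && (block col (col i) \subset S)].

Lemma esym_gf_block c : c != 0%N -> coef_ideal J (esym_gf (block col c) - 1).
Proof.
move=> c0 k; rewrite coefB coef_esym_gf coef1.
case: k => [|k]; first by rewrite esymS0 subrr; apply: (ideal0 idJ).
by rewrite subr0; apply: (alt_ideal_esymS_block fil c0).
Qed.

Lemma esym_gf_full S : coef_ideal J (esym_gf (full S) - 1).
Proof.
rewrite /esym_gf (partition_big (fun i => Ordinal (col_bound i)) xpredT) //=.
apply: (big_ind (fun F => coef_ideal J (F - 1))) => [|F G JF JG|c _].
- by rewrite subrr; apply: (ideal0 idJy).
- have -> : F * G - 1 = F * (G - 1) + (F - 1) by ring.
  by apply: (idealD idJy) => //; apply: (idealM idJy).
case: (boolP ((c != 0%N :> nat) && (block col c \subset S))) => [/andP[c0 cS]|Nc].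
  rewrite (eq_bigl (mem (block col c))); first exact: esym_gf_block.
  move=> i; rewrite !inE -val_eqE /=.
  by case: (eqVneq (col i) c) => [->|_]; rewrite ?andbF // c0 cS.
rewrite big_pred0 ?subrr; first exact: (ideal0 idJy).
move=> i; rewrite !inE -val_eqE /=.
by case: (eqVneq (col i) c) => [->|_]; rewrite ?andbF // (negPf Nc).
Qed.

Lemma full_sub S : full S \subset S.
Proof.
by apply/subsetP => i; rewrite inE => /andP[_ /subsetP]; apply; rewrite in_block.
Qed.

(** Each of the m - |S| missing elements spoils at most one column. *)
Lemma tailsum_full (S : {set 'I_n}) : (forall i, i \in S -> (i < m)%N) ->
  (tailsum la (m - #|S|) <= #|full S|)%N.
Proof.
move=> Sm; set M := sumn la; set t := (m - #|S|)%N.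
pose C : {set 'I_M} := [set c : 'I_M | block col c.+1 \subset S].
have leC : (#|~: C| <= t)%N.
  have exP (c : 'I_M) : c \in ~: C -> exists i, (i \notin S) && (col i == c.+1).
    rewrite !inE => /subsetPn[i]; rewrite in_block => ci iS.
    by exists i; rewrite iS ci.
  pose f (c : 'I_M) : option 'I_n := [pick i | (i \notin S) && (col i == c.+1)].
  have fP c : c \in ~: C -> exists2 i, f c = Some i & (i \notin S) && (col i == c.+1).
    move=> /exP[i iP]; rewrite /f.
    by case: pickP => [j jP|/(_ i)]; [exists j | rewrite iP].
  have finj : {in ~: C &, injective f}.
    move=> c d /fP[i -> /andP[_ /eqP ci]] /fP[j -> /andP[_ /eqP dj]] [eij].
    by apply/val_inj; rewrite eij dj in ci; case: ci.
  rewrite -(card_in_imset finj).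
  pose D : {set 'I_n} := [set i : 'I_n | (i < m)%N && (i \notin S)].
  have : f @: (~: C) \subset [set Some i | i in D].
    apply/subsetP => _ /imsetP[c /fP[i -> /andP[iS /eqP ci]] ->].
    apply: imset_f; rewrite inE iS andbT ltnNge; apply/negP => /ina[].
    by rewrite ci.
  move=> /subset_leq_card /leq_trans; apply.
  rewrite card_imset; last by move=> ? ? [].
  have : (#|D :|: S| <= m)%N.
    by apply: card_init_leq => i; rewrite !inE => /orP[/andP[]//|/Sm].
  rewrite cardsU (_ : D :&: S = set0) ?cards0; first by rewrite /t; lia.
  by apply/setP => i; rewrite !inE; case: (i \in S); rewrite ?andbF.
have -> : #|full S| = (\sum_(c in C) conj_part la c.+1)%N.
  pose F (c : 'I_M) := if c \in C then block col c.+1 else set0.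
  have -> : full S = \bigcup_c F c.
    apply/setP => i; rewrite inE; apply/andP/bigcupP => [[c0 cS]|[c _]].
      have lt : ((col i).-1 < M)%N by have := col_bound i; rewrite /M; lia.
      exists (Ordinal lt) => //; rewrite /F inE /= prednK ?lt0n // cS.
      by rewrite in_block.
    by rewrite /F; case: ifP; rewrite !inE // => cS /eqP ->.
  rewrite -sum1_card partition_disjoint_bigcup /=; last first.
    move=> c d; apply: contraNT => /pred0Pn[i /=].
    rewrite /F; do 2!case: ifP => _; rewrite !inE ?andbF //.
    by move=> /andP[/eqP -> /eqP[eq_cd]]; apply/eqP/val_inj.
  rewrite [RHS]big_mkcond /=; apply: eq_bigr => c _; rewrite sum1_card /F.
  by case: ifP => _; rewrite ?cards0 //; apply: card_block fil _.
rewrite /conj_part /tailsum.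
under [X in (_ <= X)%N]eq_bigr => c _ do rewrite -sum1_count big_mkcond.
rewrite exchange_big /= big_seq [X in (_ <= X)%N]big_seq; apply: leq_sum => a ala.
have leaM : (a <= M)%N by rewrite /M sumnE (big_rem a) //= leq_addr.
rewrite -big_mkcondr /= sum1dep_card leq_subLR.
have Ea : (#|[set c : 'I_M | (c < a)%N]| = a)%N.
  have winj : injective (widen_ord leaM) by move=> i j [] /val_inj.
  rewrite -[RHS]card_ord -(card_imset _ winj); apply: eq_card => c.
  rewrite inE; apply/idP/imsetP => [lt|[i _ ->] /=]; last exact: ltn_ord.
  by exists (Ordinal lt); last exact: val_inj.
rewrite -{1}Ea; apply: leq_trans (leq_add leC (leqnn _)).
rewrite -cardsUI; apply: leq_trans (leq_addr _ _).
by apply/subset_leq_card/subsetP => c; rewrite !inE /= => ->; rewrite andbT orNb.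
Qed.

(** Modulo the ideal, the columns contained in S do not contribute to the
    generating function of S, so e_d(S) vanishes when d exceeds the number of
    other elements. *)
Lemma alt_ideal_init f : init_ideal m la f -> J f.
Proof.
apply: gen_idealS => // {}f [[S [d [Sm lt ->]]]|[j mj ->] q]; last first.
  apply: altf_monomials => u; rewrite -mpolyXD /altf big1 // => s /colpermP sP.
  rewrite mcoeffX; case: eqP => [E|]; last by rewrite mulr0.
  have := congr1 (fun u : 'X_{1..n} => u j) E; rewrite mnmDE mnm1E eqxx mnmE.
  by have [cj dj] := ina mj; rewrite (sP j).2 // dj.
have fS := full_sub S.
have : coef_ideal J (esym_gf S - esym_gf (S :\: full S)).
  have -> : esym_gf S - esym_gf (S :\: full S) =
      (esym_gf (full S) - 1) * esym_gf (S :\: full S).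
    rewrite mulrBl mul1r; congr (_ - _); rewrite /esym_gf (big_setID (full S)) /=.
    by congr (_ * _); apply: eq_bigl => i; rewrite (setIidPr fS).
  by rewrite mulrC; apply: (idealM idJy); apply: esym_gf_full.
move=> /(_ d); rewrite coefB !coef_esym_gf [X in _ - X]esymS_gt ?subr0 //.
rewrite cardsD (setIidPr fS); have := tailsum_full Sm; have := subset_leq_card fS.
lia.
Qed.

End Kill.

(** * The intersection of the alternating ideals *)

(** f lies in the alternating ideals of all fillings of la in the first m
    variables. *)
Definition in_alt_ideals n m la (f : {mpoly rat[n]}) : Prop :=
  forall col dl, filling (conj_part la) col dl -> inactive col dl m ->
  alt_ideal col dl f.

Lemma altf_trivial n (f : {mpoly rat[n]}) :
  altf (fun=> 0%N) (fun=> 0%N) f = f@_0%MM.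
Proof.
rewrite /altf (big_pred1 (1%g : 'S_n)) => [|s]; last first.
  apply/colpermP/eqP => [sP|-> i]; last by rewrite perm1.
  by apply/permP => i; rewrite perm1; apply: (sP i).2.
rewrite odd_perm1 mul1r; congr mcoeff; apply/mnmP => i; by rewrite !mnmE.
Qed.

Lemma init_ideal_of_alt0 n la (f : {mpoly rat[n]}) :
  in_alt_ideals 0 la f -> init_ideal 0 la f.
Proof.
move=> altIf; have idI := @init_ideal_is_ideal n 0 la.
have [t0|] := posnP (tailsum la 0); last first.
  move=> tpos; rewrite -[f]mulr1; apply: (idealM idI).
  apply: gen_ideal_mem; left; exists set0, 0%N; rewrite esymS0 cards0; split=> // i.
  by rewrite inE.
have fil : filling (conj_part la) (fun=> 0%N) (fun _ : 'I_n => 0%N).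
  split=> // c a; case: c => // c _ lta; exfalso; move: lta.
  have := tailsumS la 0.
  have : (conj_part la c.+1 <= conj_part la 1)%N by apply: leq_conj_part.
  by rewrite t0; lia.
have f0 : f@_0%MM = 0.
  by rewrite -altf_trivial; apply/alt_ideal_altf/altIf.
rewrite [f]mpolyE big_seq; apply: (ideal_sum _ idI) => u uf.
rewrite -mul_mpolyC; apply: (idealM idI).
have /eqP : u != 0%MM.
  by apply: contraTneq uf => ->; rewrite mcoeff_msupp f0 eqxx.
move/eqP; rewrite -mdeg_eq0 mdegE sum_nat_eq0 negb_forall => /existsP[j /= uj].
have -> : u = (u - U_(j) + U_(j))%MM.
  by rewrite submK //; apply/mnm_lepP => i; rewrite mnm1E; case: eqP => // <-; rewrite lt0n.
rewrite mpolyXD; apply: (idealM idI); apply: gen_ideal_mem; right; by exists j.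
Qed.

(** f is reduced modulo the ideal to a multiple of x^i, for each i. *)
Lemma init_ideal_of_alt_step n m la (x : 'I_n) (f : {mpoly rat[n]}) : val x = m ->
  (forall la' (g : {mpoly rat[n]}), in_alt_ideals m la' g -> init_ideal m la' g) ->
  in_alt_ideals m.+1 la f ->
  forall i, exists2 g, init_ideal m.+1 la g & exists h, f = g + 'X_x ^+ i * h.
Proof.
move=> xm IH altIf; have idI := @init_ideal_is_ideal n m.+1 la.
elim=> [|i [g Ig [h fE]]].
  by exists 0; [apply: (ideal0 idI) | exists f; rewrite add0r mul1r].
suff [c [cla hc alth]] : exists c, [/\ c != 0%N -> c \in la,
    forall t, (c <= t)%N -> (conj_part la t.+1 <= i)%N & in_alt_ideals m (dec_part c la) h].
  have [h' Ih'] := init_ideal_step xm cla hc (IH _ _ alth).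
  exists (g + ('X_x ^+ i * h - 'X_x ^+ i.+1 * h')); first exact: (idealD idI).
  by exists h'; rewrite fE -addrA subrK.
have [c hc cP] := exists_cut la i; exists c.
have cla : c != 0%N -> c \in la by move=> /cP[].
split=> // col' dl' fil' ina'.
have [cx0 dx0] : col' x = 0%N /\ dl' x = 0%N by apply: ina'; rewrite xm.
(* x is added at the end of column c, or with exponent i if c = 0 *)
pose e := if c == 0%N then i else (conj_part la c).-1.
pose col k := if k == x then c else col' k.
pose dl k := if k == x then e else dl' k.
have le_ie : (i <= e)%N.
  by rewrite /e; case: ifP => // /negbT /cP[_]; lia.
have eqo k : k != x -> col k = col' k /\ dl k = dl' k.
  by move=> /negPf kx; rewrite /col /dl kx.
have bE j : j != 0%N -> (conj_part la j = conj_part (dec_part c la) j + (j == c))%N.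
  exact: conj_part_dec.
have dlc k : c != 0%N -> k != x -> col' k = c -> (dl' k < e)%N.
  move=> c0 kx ck; have := filling_lt fil' (i := k); rewrite ck => /(_ c0).
  by rewrite /e (negPf c0) bE // eqxx; lia.
have fil : filling (conj_part la) col dl.
  split=> [k|k l|j a j0].
  - rewrite /col /dl; case: (eqVneq k x) => [_ c0|kx c0].
      by rewrite /e (negPf c0) prednK // bE // eqxx addn1.
    by rewrite bE //; have := filling_lt fil' c0; lia.
  - rewrite /col /dl; case: (eqVneq k x) => [->|kx]; case: (eqVneq l x) => [->//|lx] c0.
    + by move=> /esym cl el; have := dlc l c0 lx cl; rewrite el ltnn.
    + move=> cl el; rewrite cl in c0; by have := dlc k c0 kx cl; rewrite el ltnn.
    by apply: (filling_inj fil').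
  rewrite bE // => lta; case: (eqVneq j c) lta => [jc|jc] lta; last first.
    have [//|k ck dk] := filling_surj fil' (c := j) (a := a) j0; first lia.
    have kx : k != x by apply: contra_neq j0 => kx; rewrite -ck kx.
    by exists k; rewrite ?(eqo k kx).1 ?(eqo k kx).2.
  case: (ltnP a e) => lae.
    have [//|k ck dk] := filling_surj fil' (c := j) (a := a) j0.
      by move: lae; rewrite /e -jc (negPf j0) bE // jc eqxx; lia.
    have kx : k != x by apply: contra_neq j0 => kx; rewrite -ck kx.
    by exists k; rewrite ?(eqo k kx).1 ?(eqo k kx).2.
  exists x; rewrite /col /dl eqxx //.
  by move: lae lta; rewrite /e -jc (negPf j0) bE // jc eqxx; lia.
have ina : inactive col dl m.+1.
  move=> k mk; have kx : k != x by apply: contraTneq mk => ->; rewrite xm ltnn.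
  by rewrite !(eqo k kx).1 (eqo k kx).2; apply/ina'/ltnW.
have Jf := altIf _ _ fil ina.
have Jg := alt_ideal_init fil ina Ig.
have Jh : alt_ideal col dl ('X_x ^+ i * h).
  have -> : 'X_x ^+ i * h = f - g by rewrite fE addrC addKr.
  exact: (idealB (alt_ideal_is_ideal col dl)).
move=> q; rewrite -(@altf_add_cell _ col dl col' dl' x) //; last first.
  rewrite /col eqxx => c0 k kx; rewrite (negPf kx) => ck.
  by rewrite /dl eqxx (negPf kx); apply: dlc.
have -> : dl x = (e - i + i)%N by rewrite /dl eqxx subnK.
have := Jh ('X_x ^+ (e - i) * q); congr (altf _ _ _ = _).
by rewrite exprD; ring.
Qed.

Lemma init_ideal_of_alt n m la (f : {mpoly rat[n]}) : (m <= n)%N ->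
  in_alt_ideals m la f -> init_ideal m la f.
Proof.
elim: m la f => [|m IH] la f; first by move=> _; apply: init_ideal_of_alt0.
move=> lt_mn altIf; pose x := Ordinal lt_mn.
have idI := @init_ideal_is_ideal n m.+1 la.
have IH' la' (g : {mpoly rat[n]}) : in_alt_ideals m la' g -> init_ideal m la' g.
  exact/IH/ltnW.
have [g Ig [h fE]] := init_ideal_of_alt_step (erefl (val x)) IH' altIf (msize f).
(* the multiple of x^(msize f) has no component in a degree < msize f *)
rewrite (pihomog_partitionE (leqnn (mmeasure mdeg f))).
apply: (ideal_sum _ idI) => d _; move: (nat_of_ord d) (ltn_ord d) => {}d lt_d.
suff -> : pihomog mdeg d f = pihomog mdeg d g by apply: init_ideal_homogeneous.
rewrite {1}fE raddfD /= (_ : pihomog mdeg d (_ * h) = 0) ?addr0 //.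
rewrite [h](pihomog_partitionE (leqnn (mmeasure mdeg h))) mulr_sumr raddf_sum.
rewrite big1 // => k _ /=.
rewrite (@pihomog_ne0 _ _ _ (msize f + k)) //.
  by rewrite gtn_eqF // ltn_addr.
apply: dhomogM; last exact: pihomogP.
by rewrite -[X in X.-homog]mul1n; apply: dhomogMn; rewrite dhomogX /= mdeg1.
Qed.

(** * Cyclic nilpotent blocks *)

Lemma mxrank_nonzero_rows (F : fieldType) m n (Z : 'M[F]_(m, n)) (B : {set 'I_m}) :
  (forall i, i \notin B -> row i Z = 0) -> (\rank Z <= #|B|)%N.
Proof.
move=> Z0; have : (Z <= \sum_(i in B) <<row i Z>>)%MS.
  apply/row_subP => i; case: (boolP (i \in B)) => [iB|/Z0 ->]; last exact: sub0mx.
  by rewrite (sumsmx_sup i) // genmxE.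
move=> /mxrankS /leq_trans; apply.
apply: leq_trans (mxrank_sum_leqif _) _ => /=.
rewrite -sum1_card; apply: leq_sum => i _; rewrite mxrank_gen; exact: rank_leq_row.
Qed.

Section Cyclic.

Variables (n' : nat) (b : nat -> nat) (col dl : 'I_n'.+1 -> nat).
Hypothesis fil : filling b col dl.
Local Notation n := n'.+1.

(** The element of column c with number a. *)
Definition cell c a : 'I_n := odflt ord0 [pick i | (col i == c) && (dl i == a)].

Lemma cellP c a : c != 0%N -> (a < b c)%N -> col (cell c a) = c /\ dl (cell c a) = a.
Proof.
move=> c0 lt; have [i ci di] := filling_surj fil c0 lt; rewrite /cell.
by case: pickP => [j /andP[/eqP ? /eqP ?] //|/(_ i)]; rewrite ci di !eqxx.
Qed.

Lemma cell_id i : col i != 0%N -> cell (col i) (dl i) = i.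
Proof.
move=> c0; have [cc dc] := cellP c0 (filling_lt fil c0).
by apply: (filling_inj fil); rewrite ?cc.
Qed.

Lemma big_block (R : Type) (idx : R) (op : Monoid.com_law idx) c (F : 'I_n -> R) :
  c != 0%N -> \big[op/idx]_(k in block col c) F k = \big[op/idx]_(a < b c) F (cell c a).
Proof.
move=> c0; have -> : block col c = [set cell c a | a : 'I_(b c)].
  apply/setP => i; rewrite in_block; apply/eqP/imsetP => [ci|[a _ ->]]; last first.
    exact: (cellP c0 (ltn_ord a)).1.
  have lt : (dl i < b c)%N by rewrite -ci; apply: (filling_lt fil); rewrite ci.
  by exists (Ordinal lt) => //=; rewrite -ci cell_id // ci.
rewrite big_imset //= => a a' _ _ /(congr1 dl).
by rewrite !(cellP c0 _).2 // => /val_inj.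
Qed.

(** The Newton basis of {poly R} attached to the points - x_i, i in column c. *)
Definition newton (R : comNzRingType) (x : 'I_n -> R) c a : {poly R} :=
  \prod_(j < a) ('X + (x (cell c j))%:P).

Lemma newton_recr (R : comNzRingType) (x : 'I_n -> R) c a :
  newton x c a.+1 = newton x c a * ('X + (x (cell c a))%:P).
Proof. by rewrite /newton big_ord_recr. Qed.

Lemma size_newton (R : comNzRingType) (x : 'I_n -> R) c a : size (newton x c a) = a.+1.
Proof.
rewrite /newton; under eq_bigr => j _ do rewrite -[_%:P]opprK -polyCN.
by rewrite size_prod_XsubC /index_enum -enumT size_enum_ord.
Qed.

Lemma monic_newton (R : comNzRingType) (x : 'I_n -> R) c a : newton x c a \is monic.
Proof.
rewrite /newton; under eq_bigr => j _ do rewrite -[_%:P]opprK -polyCN.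
exact: monic_prod_XsubC.
Qed.

(** As the Newton basis is unitriangular, a polynomial with coefficients in an
    ideal has Newton coordinates in this ideal. *)
Lemma newton_expand (R : comNzRingType) (I : R -> Prop) (x : 'I_n -> R) c m
    (F : {poly R}) :
  is_ideal I -> (size F <= m)%N -> coef_ideal I F ->
  exists2 s : nat -> R, (forall a, I (s a)) &
    F = \sum_(a < m) s a *: newton x c a.
Proof.
move=> idI; elim: m F => [|m IH] F szF IF.
  exists (fun=> 0) => [_|]; first exact: (ideal0 idI).
  by rewrite big_ord0; apply/eqP; rewrite -size_poly_leq0.
pose G := F - F`_m *: newton x c m.
have [||s Is GE] := IH G.
- apply/leq_sizeP => j le_mj; rewrite /G coefB coefZ.
  case: (ltngtP m j) le_mj => // [lt _|<- _].
    rewrite (leq_sizeP _ _ szF j) // (_ : (newton x c m)`_j = 0) ?mulr0 ?subrr //.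
    by apply: nth_default; rewrite size_newton.
  have := monicP (monic_newton x c m); rewrite lead_coefE size_newton /= => ->.
  by rewrite mulr1 subrr.
- move=> k; rewrite /G coefB coefZ; apply: (idealB idI) => //.
  by rewrite mulrC; apply: (idealM idI).
exists (fun a => if a == m then F`_m else s a).
  by move=> a; case: eqP.
rewrite big_ord_recr /= eqxx; apply/eqP; rewrite -subr_eq; apply/eqP.
rewrite -/G GE; apply: eq_bigr => a _.
by rewrite ltn_eqF.
Qed.

(** On the basis vectors of a column, A acts as multiplication by the variable on
    the Newton basis of the quotient of {poly rat} by 'X^(b c); hence it is
    nilpotent and cyclic there, with the first vector of the column as a cyclic
    vector.  Its action on the other basis vectors is arbitrary. *)
Section Rank.
Variables (A : 'M[rat]_n) (x : 'I_n -> rat) (s : nat -> nat -> rat).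
Local Notation e i := (delta_mx 0 i : 'rV[rat]_n).
Hypothesis sE : forall c, c != 0%N ->
  'X^(b c) = newton x c (b c) + \sum_(a < b c) s c a *: newton x c a.
Hypothesis rowA : forall c a, c != 0%N -> (a.+1 < b c)%N ->
  e (cell c a) *m A = e (cell c a.+1) - x (cell c a) *: e (cell c a).
Hypothesis lastA : forall c a, c != 0%N -> a.+1 = b c ->
  e (cell c a) *m A =
  - (\sum_(a' < b c) s c a' *: e (cell c a')) - x (cell c a) *: e (cell c a).

Lemma cell_newton c a : c != 0%N -> (a < b c)%N ->
  e (cell c 0) *m horner_mx A (newton x c a) = e (cell c a).
Proof.
move=> c0; elim: a => [|a IH] lt.
  by rewrite /newton big_ord0 rmorph1 mulmx1.
rewrite newton_recr rmorphM /= -mulmxE mulmxA IH ?(ltnW lt) //.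
rewrite rmorphD /= horner_mx_X horner_mx_C mulmxDr rowA //.
by rewrite mul_mx_scalar subrK.
Qed.

Lemma cell_nilp c : c != 0%N -> (0 < b c)%N -> e (cell c 0) *m A ^+ b c = 0.
Proof.
move=> c0 bpos; have -> : A ^+ b c = horner_mx A 'X^(b c).
  by rewrite rmorphXn /= horner_mx_X.
rewrite sE // rmorphD mulmxDr /=.
have bE : (b c).-1.+1 = b c by rewrite prednK.
rewrite -[in newton _ _ (b c)]bE newton_recr rmorphM /= -mulmxE mulmxA.
rewrite cell_newton ?bE // rmorphD /= horner_mx_X horner_mx_C mulmxDr lastA //.
rewrite mul_mx_scalar subrK rmorph_sum /= mulmx_sumr.
under [X in _ + X]eq_bigr => a _ do rewrite linearZ /= -scalemxAr cell_newton //.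
by rewrite addNr.
Qed.

(** The vectors A^a e_c, with e_c the first vector of column c, and the basis
    vectors outside the columns span the whole space, and A^d kills those with
    a + d >= b c. *)
Lemma mxrank_cyclic d :
  (\rank (A ^+ d) <= #|[set i | (col i == 0%N) || (dl i + d < b (col i))%N]|)%N.
Proof.
pose u i := if col i == 0%N then e i else e (cell (col i) 0) *m A ^+ dl i.
pose U := \matrix_i u i.
have fullU : (1%:M <= U)%MS.
  apply/row_subP => i; rewrite row1.
  case: (eqVneq (col i) 0%N) => [c0|c0].
    have -> : e i = row i U by rewrite rowK /u c0 eqxx.
    exact: row_sub.
  have lt := filling_lt fil c0.
  rewrite -{1}(cell_id c0) -cell_newton // -[newton _ _ _]coefK poly_def rmorph_sum /=.
  rewrite mulmx_sumr summx_sub // => k _.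
  rewrite linearZ /= rmorphXn /= horner_mx_X -scalemxAr scalemx_sub //.
  have ltk : (k < b (col i))%N.
    by apply: leq_trans (ltn_ord k) _; rewrite size_newton.
  have [ck dk] := cellP c0 ltk.
  have -> : e (cell (col i) 0) *m A ^+ k = row (cell (col i) k) U.
    by rewrite rowK /u ck dk (negPf c0).
  exact: row_sub.
have : (A ^+ d <= U *m A ^+ d)%MS by rewrite -{1}[A ^+ d]mul1mx submxMr.
move=> /mxrankS /leq_trans; apply; apply: mxrank_nonzero_rows => i.
rewrite inE negb_or -leqNgt => /andP[c0 le_b].
rewrite row_mul rowK /u (negPf c0) -mulmxA mulmxE -exprD -(subnK le_b) addnC exprD.
rewrite -mulmxE mulmxA cell_nilp ?mul0mx //.
exact: leq_ltn_trans (leq0n _) (filling_lt fil c0).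
Qed.

End Rank.

End Cyclic.

(** * Evaluation of polynomials at matrices of polynomials *)

Lemma digits_inj N n (f g : nat -> nat) :
  (forall i, f i < N)%N -> (forall i, g i < N)%N ->
  (\sum_(i < n) f i * N ^ i = \sum_(i < n) g i * N ^ i)%N ->
  forall i, (i < n)%N -> f i = g i.
Proof.
elim: n f g => [//|n IH] f g fN gN; rewrite !big_ord_recl /= !muln1.
have shift (h : nat -> nat) : (\sum_(i < n) h (bump 0 i) * N ^ bump 0 i =
    (\sum_(i < n) h i.+1 * N ^ i) * N)%N.
  by rewrite big_distrl; apply: eq_bigr => i _; rewrite /bump add1n expnS mulnCA mulnC.
rewrite !shift => E.
have E0 : f 0%N = g 0%N.
  by have := congr1 (modn^~ N) E; rewrite /= ![(_ + _ * N)%N]addnC !modnMDl !modn_small.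
move: E; rewrite E0 => /addnI /eqP; rewrite eqn_pmul2r ?(leq_ltn_trans _ (fN 0%N)) //.
move=> /eqP E; case=> [//|i] lt; apply: (IH (fun i => f i.+1) (fun i => g i.+1)) => //.
Qed.

Lemma poly_rat_eq0 (q : {poly rat}) : (forall t, q.[t] = 0) -> q = 0.
Proof.
move=> q0; apply/eqP/negPn/negP => nz.
pose rs : seq rat := [seq i%:R | i <- iota 0 (size q)].
have : all (root q) rs by apply/allP => t _; rewrite /root q0.
move=> /(max_poly_roots nz); rewrite size_map size_iota ltnn => /(_ _)/notF; apply.
rewrite map_inj_uniq ?iota_uniq // => i j.
by move/eqP; rewrite Num.Theory.eqr_nat => /eqP.
Qed.

(** By Kronecker substitution: x_i is replaced by the power N^i of a single
    variable, where N exceeds all exponents. *)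
Lemma mpoly_rat_eq0 n (p : {mpoly rat[n]}) : (forall v, p.@[v] = 0) -> p = 0.
Proof.
move=> p0; pose N := msize p.
pose code (m : 'X_{1..n}) := (\sum_(i < n) m i * N ^ i)%N.
pose q : {poly rat} := \sum_(m <- msupp p) p@_m *: 'X^(code m).
have q0 : q = 0.
  apply: poly_rat_eq0 => t; rewrite /q horner_sum -[RHS](p0 (fun i => t ^+ (N ^ i))).
  rewrite mevalE; apply: eq_bigr => m _; rewrite hornerZ hornerXn; congr (_ * _).
  by rewrite /code -prodrXr; apply: eq_bigr => i _; rewrite mulnC exprM.
apply/mpolyP => m; rewrite mcoeff0.
case: (boolP (m \in msupp p)) => [mp|]; last by move/memN_msupp_eq0.
have := congr1 (fun r : {poly rat} => r`_(code m)) q0.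
rewrite coef0 /q coef_sum (big_rem m) //= coefZ coefXn eqxx mulr1 big_seq.
rewrite big1 ?addr0 // => u.
rewrite mem_rem_uniq ?msupp_uniq // inE => /andP[num up].
rewrite coefZ coefXn; case: eqP => [E|]; rewrite ?mulr0 //.
case/eqP: num; apply/mnmP => i.
have ltN w j : w \in msupp p -> (w j < N)%N.
  move=> /msize_mdeg_lt; apply: leq_ltn_trans; rewrite mdegE (bigD1 j) //= leq_addr //.
have Npos : (0 < N)%N by apply: leq_ltn_trans (ltN _ i mp).
pose ext (w : 'X_{1..n}) j := if insub j is Some k then w k else 0%N.
have extE w (k : 'I_n) : ext w k = w k by rewrite /ext valK.
have extN w : w \in msupp p -> forall j, (ext w j < N)%N.
  by move=> wp j; rewrite /ext; case: insubP => [k _ _|_] //; apply: ltN.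
rewrite -!extE; apply: (@digits_inj N n) => //; try exact: extN.
by move: E; rewrite /code; under [LHS]eq_bigr => k _ do rewrite -extE;
  under [RHS]eq_bigr => k _ do rewrite -extE.
Qed.

Section Subst.
Variable n : nat.
Implicit Types (X Y : 'M[{mpoly rat[n]}]_n) (p : {mpoly rat[n * n]}).

(** The value of a polynomial function of matrices at a matrix of polynomials. *)
Definition mx_subst X p : {mpoly rat[n]} :=
  mmap (@mpolyC n rat) (fun k => mxvec X 0 k) p.

HB.instance Definition _ X := GRing.RMorphism.copy (mx_subst X)
  (mmap (@mpolyC n rat) (fun k => mxvec X 0 k)).

Lemma mx_substZ X c p : mx_subst X (c *: p) = c *: mx_subst X p.
Proof. by rewrite /mx_subst mmapZ mul_mpolyC. Qed.

Lemma meval_mx_subst v X p : (mx_subst X p).@[v] = mx_eval p (map_mx (meval v) X).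
Proof.
rewrite /mx_subst /mx_eval /mmap raddf_sum mevalE; apply: eq_bigr => m _ /=.
rewrite mevalM mevalC /mmap1 rmorph_prod; congr (_ * _); apply: eq_bigr => k _.
by rewrite rmorphXn /= -map_mxvec mxE.
Qed.

Lemma mx_subst_cong (I : {mpoly rat[n]} -> Prop) X Y p : is_ideal I ->
  (forall i j, I (X i j - Y i j)) -> I (mx_subst X p - mx_subst Y p).
Proof.
move=> idI IXY; rewrite /mx_subst /mmap -sumrB; apply: (ideal_sum _ idI) => m _.
rewrite -mulrBr; apply: (idealM idI).
have IM a a' c c' : I (a - a') -> I (c - c') -> I (a * c - a' * c').
  move=> Ia Ic; have -> : a * c - a' * c' = c * (a - a') + a' * (c - c') by ring.
  by apply: (idealD idI); apply: (idealM idI).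
rewrite /mmap1; apply: (big_ind2 (fun a a' => I (a - a'))) => [|*|k _].
- by rewrite subrr; apply: (ideal0 idI).
- exact: IM.
have Ik : I (mxvec X 0 k - mxvec Y 0 k).
  by case/mxvec_indexP: k => i j; rewrite !mxvecE.
elim: (m k) => [|e IH]; first by rewrite subrr; apply: (ideal0 idI).
by rewrite !exprS; apply: IM.
Qed.

(** Restriction to the diagonal matrices. *)
Definition diag_res p := mx_subst (diag_mx (\row_i 'X_i)) p.

HB.instance Definition _ := GRing.RMorphism.copy diag_res
  (mx_subst (diag_mx (\row_i 'X_i))).

Lemma mx_subst_sum X p :
  mx_subst X p = \sum_(m <- msupp p) p@_m *: mx_subst X 'X_[m].
Proof.
rewrite {1}[p]mpolyE raddf_sum; apply: eq_bigr => m _.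
exact: mx_substZ.
Qed.

Lemma mx_substX X m : mx_subst X 'X_[m] = \prod_k (mxvec X 0 k) ^+ m k.
Proof. by rewrite /mx_subst mmapX. Qed.

Lemma mx_substX_homog (X : 'M[{mpoly rat[n]}]_n) (w : 'M[nat]_n) m :
  (forall i j, X i j \is (w i j).-homog) ->
  mx_subst X 'X_[m] \is (\sum_k mxvec w 0%R k * m k)%N.-homog.
Proof.
move=> hX; rewrite mx_substX; elim/big_rec2: _ => [|k d q _ hq]; first exact: dhomog1.
apply: dhomogM hq; apply: dhomogMn; case/mxvec_indexP: k => i j; by rewrite !mxvecE.
Qed.

Lemma diag_mx_homog i j :
  (diag_mx (\row_k 'X_k) : 'M[{mpoly rat[n]}]_n) i j \is 1.-homog.
Proof.
rewrite !mxE; case: eqP => [->|_]; last exact: dhomog0.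
by rewrite mulr1n dhomogX /= mdeg1.
Qed.

Lemma diag_res_homog d p :
  p \is d.-homog -> diag_res p \is d.-homog.
Proof.
move=> /dhomogP hp; rewrite /diag_res mx_subst_sum big_seq; apply: rpred_sum => m /hp <-.
apply: rpredZ => /=.
have := @mx_substX_homog (diag_mx (\row_i 'X_i)) (\matrix_(i, j) 1%N) m.
rewrite mdegE (eq_bigr (fun k => m k)) => [|k _]; last first.
  by case/mxvec_indexP: k => i j; rewrite mxvecE mxE mul1n.
by apply=> i j; rewrite [X in X.-homog]mxE; apply: diag_mx_homog.
Qed.

End Subst.

Lemma altf_homog n (col dl : 'I_n -> nat) e (f : {mpoly rat[n]}) :
  f \is e.-homog -> e != (\sum_i dl i)%N -> altf col dl f = 0.
Proof.
move=> hf ne; rewrite /altf big1 // => s _.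
rewrite (dhomog_nemf_coeff hf) ?mulr0 //  [X in X != _]mdegE eq_sym.
apply: contra ne => /eqP ->; apply/eqP.
rewrite [RHS](reindex_inj (@perm_inj _ s)) /=.
by apply: eq_bigr => i _; rewrite mnmE.
Qed.

Lemma sum_nat_geq b d : (\sum_(a < b) (b <= a + d) = minn b d)%N.
Proof.
rewrite (reindex_inj rev_ord_inj) /=.
rewrite (eq_bigr (fun a : 'I_b => (a < d)%N : nat)) => [|a _]; last first.
  by have := ltn_ord a; lia.
by elim: b => [|b IH]; rewrite ?big_ord0 ?min0n // big_ord_recr /= IH; lia.
Qed.

Lemma coef_prod_XaddC (A : comNzRingType) (I : finType) (S : {set I})
    (u : I -> A) j :
  (j <= #|S|)%N -> (\prod_(i in S) ('X + (u i)%:P))`_j =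
  \sum_(T : {set I} | (T \subset S) && (#|T| == (#|S| - j)%N)) \prod_(i in T) u i.
Proof.
move=> le_j; under eq_bigr => i _ do rewrite addrC.
rewrite prodD_subsets coef_sum big_mkcondr /=; apply: eq_bigr => T TS.
rewrite -rmorph_prod /= prodr_const coefCM coefXn cardsD (setIidPr TS).
have := subset_leq_card TS => leT.
rewrite (_ : (j == _) = (#|T| == #|S| - j)%N); last lia.
by case: eqP; rewrite ?mulr1 ?mulr0.
Qed.

(** * Functions vanishing on the rank variety *)

Section Deform.

Variables (n' : nat) (la : seq nat) (col dl : 'I_n'.+1 -> nat).
Local Notation n := n'.+1.
Local Notation b := (conj_part la).
Hypothesis fil : filling b col dl.
Local Notation P := {mpoly rat[n]}.
Local Notation J := (alt_ideal col dl).
Let idJ : is_ideal J := alt_ideal_is_ideal col dl.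
Local Notation x := (fun i : 'I_n => 'X_i : P).
Local Notation cl := (cell col dl).
Local Notation nw := (newton col dl).

Lemma coef_subXn_newton c j : (b c <= j)%N -> ('X^(b c) - nw x c (b c))`_j = 0.
Proof.
rewrite coefB coefXn; case: (ltngtP j (b c)) => // [lt _|-> _].
  by rewrite nth_default ?subrr // size_newton.
have := monicP (monic_newton col dl x c (b c)).
by rewrite lead_coefE size_newton /= => ->; rewrite subrr.
Qed.

(** The coefficients in question are elementary symmetric polynomials of
    column c, up to sign. *)
Lemma newton_coefs c : c != 0%N -> coef_ideal J ('X^(b c) - nw x c (b c)).
Proof.
move=> c0 j; have B := card_block fil c0.
have nwE : nw x c (b c) = \prod_(k in block col c) ('X + (x k)%:P).
  by rewrite (big_block fil).
have [lt|le] := ltnP j (b c); last first.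
  by rewrite coef_subXn_newton //; apply: (ideal0 idJ).
rewrite coefB coefXn ltn_eqF // sub0r; apply: (idealN idJ).
rewrite nwE coef_prod_XaddC ?B ?(ltnW lt) //.
by apply: (alt_ideal_esymS_block fil c0); rewrite subn_gt0.
Qed.

Lemma exists_newton : exists s : nat -> nat -> P,
  (forall c a, c != 0%N -> J (s c a)) /\
  (forall c, c != 0%N ->
    'X^(b c) = nw x c (b c) + \sum_(a < b c) s c a *: nw x c a).
Proof.
have /choice[s sP] : forall c, exists s : nat -> P, c != 0%N ->
  (forall a, J (s a)) /\ 'X^(b c) = nw x c (b c) + \sum_(a < b c) s a *: nw x c a.
  move=> c; case: (eqVneq c 0%N) => [_|c0]; first by exists (fun=> 0).
  have [|s Is sE] := newton_expand col dl x c idJ _ (newton_coefs c0) (m := b c).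
    by apply/leq_sizeP => j; apply: coef_subXn_newton.
  by exists s => _; split=> //; rewrite -sE addrC subrK.
by exists s; split=> [c a /sP[]|c /sP[]].
Qed.

Definition succ_cell i j := [&& col i != 0%N, col j == col i & dl j == (dl i).+1].

(** The diagonal matrix of the variables, minus the shift along the columns. *)
Definition shift_mx : 'M[P]_n :=
  \matrix_(i, j) ((i == j)%:R * 'X_i - (succ_cell i j)%:R).

(** [shift_mx] with the coefficients [s c] added to the row of the last cell of each
    column c.  For the Newton coordinates of 'X^(b c) this makes the characteristic
    polynomial of the column a power of the variable. *)
Definition cyclic_mx (s : nat -> nat -> P) : 'M[P]_n :=
  \matrix_(i, j) (shift_mx i j +
    (if [&& col i != 0%N, col j == col i & (dl i).+1 == b (col i)]
     then s (col i) (dl j) else 0)).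

Lemma cell_eq c a j : c != 0%N -> (a < b c)%N ->
  (cl c a == j) = (col j == c) && (dl j == a).
Proof.
move=> c0 lt; have [cc dc] := cellP fil c0 lt.
apply/eqP/andP => [<-|[/eqP cj /eqP dj]]; first by rewrite cc dc !eqxx.
by apply: (filling_inj fil); rewrite ?cc ?dc.
Qed.

(** At each rational point, the matrix has a nilpotent Jordan block of size b c
    for each column c; the blocks alone account for the required dimension of the
    kernel of each power. *)
Lemma cyclic_mx_rank_variety (s : nat -> nat -> P) (v : 'I_n -> rat) :
  (forall c, c != 0%N ->
    'X^(b c) = nw x c (b c) + \sum_(a < b c) s c a *: nw x c a) ->
  rank_variety (conj_seq la) (map_mx (meval v) (cyclic_mx s)).
Proof.
move=> sE d _; set W := map_mx _ _.
pose sv c a := (s c a).@[v].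
have svE c : c != 0%N -> 'X^(b c) = nw v c (b c) + \sum_(a < b c) sv c a *: nw v c a.
  move=> c0; have := congr1 (map_poly (meval v)) (sE c c0).
  have nwv a : map_poly (meval v) (nw x c a) = nw v c a.
    rewrite /newton rmorph_prod; apply: eq_bigr => j _.
    by rewrite rmorphD /= map_polyX map_polyC /= mevalXU.
  rewrite rmorphXn /= map_polyX rmorphD /= nwv rmorph_sum /= => ->; congr (_ + _).
  by apply: eq_bigr => a _; rewrite map_polyZ nwv.
have Wij i j : (- W) i j = (succ_cell i j)%:R - (i == j)%:R * v i -
    (if [&& col i != 0%N, col j == col i & (dl i).+1 == b (col i)]
     then sv (col i) (dl j) else 0).
  rewrite !mxE mevalD mevalB mevalM mevalXU !rmorph_nat opprD opprB; congr (_ - _).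
  by case: ifP; rewrite ?meval0.
have rk : (\rank (W ^+ d) <=
    #|[set i | (col i == 0%N) || (dl i + d < b (col i))%N]|)%N.
  have -> : W ^+ d = (-1) ^+ d *: ((- W) ^+ d).
    by rewrite -expmxZ scaleN1r opprK.
  rewrite mxrank_scale_nz ?expf_neq0 ?oppr_eq0 ?oner_eq0 //.
  apply: (mxrank_cyclic fil svE) => c a c0 ab.
    have [cc dc] := cellP fil c0 (ltnW ab).
    apply/rowP => j; rewrite -rowE [LHS]mxE Wij cc dc /succ_cell cc dc c0 /=.
    rewrite (ltn_eqF ab) andbF subr0 -(cell_eq j c0 ab) !mxE eqxx /=.
    by rewrite ![j == _]eq_sym [_ * v _]mulrC.
  have lt : (a < b c)%N by rewrite -ab.
  have [cc dc] := cellP fil c0 lt.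
  apply/rowP => j; rewrite -rowE [LHS]mxE Wij cc dc /succ_cell cc dc c0 /= ab eqxx andbT.
  rewrite !mxE summxE eqxx /=.
  have -> : (col j == c) && (dl j == b c) = false.
    apply/negbTE; rewrite negb_and; case: eqP => //= cj.
    have := filling_lt fil (i := j); rewrite cj => /(_ c0) lt_j.
    by rewrite neq_ltn lt_j.
  rewrite sub0r addrC mulrC [_ == j]eq_sym; congr (- _ - _).
  case: eqP => [cj|ncj]; last first.
    rewrite big1 // => a' _; rewrite !mxE eqxx /= eq_sym cell_eq //.
    by case: eqP; rewrite ?mulr0.
  have ltj : (dl j < b c)%N by rewrite -cj; apply: (filling_lt fil); rewrite cj.
  rewrite (bigD1 (Ordinal ltj)) //= big1 ?addr0 => [|a' nea].
    by rewrite !mxE eqxx /= eq_sym cell_eq // cj !eqxx mulr1.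
  rewrite !mxE eqxx /= eq_sym cell_eq // cj eqxx /= eq_sym.
  by rewrite -val_eqE /= in nea; rewrite (negPf nea) mulr0.
rewrite mxrank_coker leq_subRL ?rank_leq_row // addnC sum_conj_part.
set E := [set i | _] in rk.
apply: leq_trans (leq_add (leqnn _) rk) _.
rewrite addnC -[leqRHS]card_ord -(cardsC E) leq_add2l.
rewrite /conj_seq big_map /= -[X in iota 0 X]subn0 -/(index_iota 0 _) big_mkord.
apply: (@leq_trans (\sum_(j < head 0%N la) \sum_(i in ~: E) (col i == j.+1))%N).
  apply: leq_sum => j _.
  have <- : (\sum_(k in block col j.+1) (b j.+1 <= dl k + d) = minn (b j.+1) d)%N.
    rewrite (big_block fil) // -sum_nat_geq; apply: eq_bigr => a _.
    by rewrite (cellP fil _ (ltn_ord a)).2.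
  rewrite big_mkcond [leqRHS]big_mkcond; apply: leq_sum => k _; rewrite !inE.
  case: (eqVneq (col k) j.+1) => [->|//] /=.
  by rewrite -leqNgt; case: (b j.+1 <= dl k + d)%N.
rewrite exchange_big -sum1_card; apply: leq_sum => i _ /=.
have -> h : (\sum_(j < h) (col i == j.+1) = (0 < col i <= h))%N; last by case: (_ && _).
by elim: h => [|h IH]; rewrite ?big_ord0 ?big_ord_recr /= ?IH; lia.
Qed.

(** A monomial involving an off-diagonal entry has value 0 at the diagonal matrix,
    and at [shift_mx] a value of degree smaller than the sum of [dl]. *)
Lemma altf_shift_diag m : mdeg m = (\sum_i dl i)%N ->
  altf col dl (mx_subst shift_mx 'X_[m]) = altf col dl (diag_res 'X_[m]).
Proof.
move=> degm.
case: (boolP [exists i, [exists j, (i != j) && (m (mxvec_index i j) != 0%N)]]).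
  case/existsP=> i /existsP[j /andP[neq mij]].
  rewrite [X in _ = altf _ _ X](_ : _ = 0); last first.
    rewrite /diag_res mx_substX (bigD1 (mxvec_index i j)) //= mxvecE !mxE (negPf neq).
    by rewrite mulr0n expr0n (negPf mij) mul0r.
  rewrite raddf0.
  pose w : 'M[nat]_n := \matrix_(i, j) (i == j : nat).
  apply: (@altf_homog _ _ _ (\sum_k mxvec w 0%R k * m k)%N).
    apply: mx_substX_homog => a c; rewrite !mxE.
    case: eqP => [<-|_]; last first.
      rewrite mul0r sub0r; case: (succ_cell a c).
        by rewrite rpredN dhomog1.
      by rewrite oppr0 dhomog0.
    rewrite mul1r (_ : succ_cell a a = false) ?subr0 ?dhomogX /= ?mdeg1 //.
    by rewrite /succ_cell [_ == (dl a).+1]ltn_eqF ?andbF.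
  rewrite -degm mdegE ltn_eqF // (bigD1 (mxvec_index i j)) //=.
  rewrite [ltnRHS](bigD1 (mxvec_index i j)) //=.
  rewrite mxvecE mxE (negPf neq) mul0n add0n -[ltnLHS]add0n.
  rewrite -addSn leq_add ?lt0n //; apply: leq_sum => k _.
  by case/mxvec_indexP: k => a c; rewrite mxvecE mxE; case: (a == c); rewrite ?mul1n ?mul0n.
rewrite negb_exists => /forallP H; congr altf; rewrite /diag_res !mx_substX.
apply: eq_bigr => k _; case/mxvec_indexP: k => i j; rewrite !mxvecE !mxE.
have := H i; rewrite negb_exists => /forallP/(_ j).
case: (eqVneq i j) => [<- _|_] /=; last by rewrite negbK => /eqP ->.
rewrite mul1r mulr1n (_ : succ_cell i i = false) ?subr0 //.
by rewrite /succ_cell [_ == (dl i).+1]ltn_eqF ?andbF.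
Qed.

Lemma altf_diag_res p :
  vanishing_ideal (@rank_variety n (conj_seq la)) p ->
  altf col dl (diag_res p) = 0.
Proof.
move=> Vp; pose D := (\sum_i dl i)%N; pose pD := pihomog mdeg D p.
have VpD : vanishing_ideal (@rank_variety n (conj_seq la)) pD.
  apply: vanishing_ideal_homogeneous Vp => c X; exact: rank_varietyZ.
have altf_sum X (q : {mpoly rat[n * n]}) :
    altf col dl (mx_subst X q) =
    \sum_(m <- msupp q) q@_m * altf col dl (mx_subst X 'X_[m]).
  by rewrite mx_subst_sum raddf_sum; apply: eq_bigr => m _; rewrite /= altfZ.
(* only the component of degree D contributes *)
have -> : altf col dl (diag_res p) = altf col dl (diag_res pD).
  rewrite /diag_res altf_sum /pD [p in RHS]mpolyE (raddf_sum (pihomog mdeg D)).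
  rewrite (raddf_sum (mx_subst _)).
  rewrite (raddf_sum (altf col dl)).
  apply: eq_bigr => m _; rewrite /= linearZ /= pihomogX mx_substZ altfZ.
  congr (_ * _); case: eqP => [//|/eqP ne]; rewrite [in RHS]raddf0 raddf0.
  by apply: (@altf_homog _ _ _ (mdeg m)) => //; apply: diag_res_homog; rewrite dhomogX.
have <- : altf col dl (mx_subst shift_mx pD) = altf col dl (diag_res pD).
  rewrite /diag_res !altf_sum big_seq [RHS]big_seq; apply: eq_bigr => m mp.
  by rewrite altf_shift_diag // (dhomog_mf (pihomogP _ _ _) mp).
have [s [Js sE]] := exists_newton.
have W0 : mx_subst (cyclic_mx s) pD = 0.
  apply: mpoly_rat_eq0 => v; rewrite meval_mx_subst; apply: VpD.
  exact: cyclic_mx_rank_variety.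
have := @mx_subst_cong _ J shift_mx (cyclic_mx s) pD idJ.
rewrite W0 subr0 => H; apply: alt_ideal_altf; apply: H => i j.
rewrite [cyclic_mx s i j]mxE opprD addNKr; apply: (idealN idJ).
case: ifP => [/and3P[c0 _ _]|_]; [exact: Js | exact: (ideal0 idJ)].
Qed.

End Deform.

(** * Coefficients of characteristic polynomials *)

Section CharPoly.
Variable F : fieldType.

Lemma char_poly_nilpotent r (N : 'M[F]_r.+1) e : N ^+ e = 0 -> char_poly N = 'X^(r.+1).
Proof.
move=> Ne; pose m : 'M[{poly F}]_r.+1 := map_mx polyC N.
pose x : 'M[{poly F}]_r.+1 := 'X%:M.
have me : m ^+ e = 0 by rewrite /m -rmorphXn Ne rmorph0.
have cxm : GRing.comm x m by rewrite /GRing.comm -!mulmxE scalar_mxC.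
have := subrXX_comm e cxm; rewrite me subr0 => /(congr1 determinant).
rewrite -mulmxE det_mulmx -rmorphXn /= det_scalar -exprM => E.
have : char_poly N %| ('X - 0%:P) ^+ (e * r.+1).
  by rewrite subr0 E; apply: dvdp_mulr; apply: dvdpp.
move=> /dvdp_exp_XsubCP[k _]; rewrite subr0 => eqk.
have kE : k = r.+1 by have := eqp_size eqk; rewrite size_char_poly size_polyXn => -[].
by move: eqk; rewrite kE eqp_monic ?char_poly_monic ?monicXn // => /eqP.
Qed.

(** The row space of K is invariant under Y, and N is the induced endomorphism;
    K is completed to an invertible matrix U, and the rows of U (X - Y) that come
    from K are (X - N) K. *)
Lemma char_poly_invariant_dvd r m (Y : 'M[F]_(r + m)) (K : 'M[F]_(r, r + m))
    (N : 'M[F]_r) :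
  row_free K -> K *m Y = N *m K -> char_poly N %| char_poly Y.
Proof.
move=> freeK KY; have rkK : \rank K = r by apply/eqP.
pose L := col_ebase K; pose E := row_ebase K.
have KE : K = L *m usubmx E.
  rewrite -{1}(mulmx_ebase K) rkK -mulmxA; congr (_ *m _).
  by rewrite pid_mx_row -{1}[row_ebase K]vsubmxK mul_row_col mul1mx mul0mx addr0.
pose U := col_mx K (dsubmx E).
have UE : U = block_mx L 0 0 1%:M *m E.
  by rewrite -{1}[E]vsubmxK mul_block_col !mul0mx mul1mx addr0 add0r -KE.
have detU : \det U != 0.
  rewrite UE det_mulmx det_ublock det1 mulr1 -unitfE unitrM -!unitmxE.
  by rewrite col_ebase_unit row_ebase_unit.
have cE : map_mx polyC U *m char_poly_mx Y =
    block_mx (char_poly_mx N) 0 0 1%:M *m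
    col_mx (map_mx polyC K) (map_mx polyC (dsubmx E) *m char_poly_mx Y).
  rewrite map_col_mx mul_col_mx mul_block_col !mul0mx mul1mx addr0 add0r.
  congr col_mx; rewrite /char_poly_mx mulmxBr mulmxBl -!map_mxM KY.
  by rewrite mul_mx_scalar mul_scalar_mx.
have := congr1 determinant cE; rewrite !det_mulmx det_map_mx det_ublock det1 mulr1 => E1.
rewrite -(@dvdpZr _ (\det U)) // -mul_polyC.
by rewrite -[char_poly Y]/(\det _) E1 dvdp_mulr.
Qed.

(** The power of the variable dividing the characteristic polynomial of Y is at
    least dim ker Y^e, for every e. *)
Lemma char_poly_coef0 n (Y : 'M[F]_n) e j :
  (j < n - \rank (Y ^+ e))%N -> (char_poly Y)`_j = 0.
Proof.
move=> lt_j; suff H r (K : 'M[F]_(r, n)) :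
    row_free K -> (j < r)%N -> (K *m Y <= K)%MS ->
    K *m Y ^+ e = 0 -> (char_poly Y)`_j = 0.
  apply: (H _ (row_base (kermx (Y ^+ e)))); rewrite ?row_base_free ?mxrank_ker //.
    rewrite (eqmxMr _ (eq_row_base _)) eq_row_base; apply/sub_kermxP.
    by rewrite -mulmxA mulmxE -exprS exprSr -mulmxE mulmxA mulmx_ker mul0mx.
  by apply/sub_kermxP; rewrite eq_row_base.
move=> freeK ltr stK Ke; have rkK : \rank K = r by apply/eqP.
have [m En] : exists m, n = (r + m)%N.
  by exists (n - r)%N; rewrite subnKC // -rkK rank_leq_col.
subst n; case: r => [//|r] in Y K freeK ltr stK Ke rkK lt_j *.
pose N := K *m Y *m pinvmx K.
have NK : K *m Y = N *m K by rewrite /N mulmxKpV.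
have Ne : N ^+ e = 0.
  apply: (row_free_inj freeK); rewrite mul0mx -[RHS]Ke.
  elim: e {lt_j Ke} => [|e IH]; first by rewrite mul1mx mulmx1.
  by rewrite exprS -mulmxE -mulmxA IH mulmxA -NK -mulmxA mulmxE -exprS.
have := char_poly_invariant_dvd freeK NK; rewrite (char_poly_nilpotent Ne).
by case/dvdpP => q ->; rewrite coefMXn ltr.
Qed.

End CharPoly.

Section Compress.
Variables (n : nat) (S : {set 'I_n}).
Local Notation t := (n - #|S|)%N.

(** The coordinate projection onto S. *)
Definition projS : 'M[rat]_n := diag_mx (\row_i (i \in S)%:R).

Lemma projS_idem : projS * projS = projS.
Proof.
rewrite -mulmxE mulmx_diag; congr diag_mx; apply/rowP => i; rewrite !mxE.
by case: (i \in S); rewrite ?mulr1 ?mulr0.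
Qed.

Lemma rank_coprojS : (\rank (1 - projS)%R <= t)%N.
Proof.
have -> : t = #|~: S| by have := cardsC S; rewrite card_ord; lia.
apply: mxrank_nonzero_rows => i; rewrite inE negbK => iS.
by apply/rowP => j; rewrite !mxE iS subrr.
Qed.

(** Each inner projection is removed at the cost of the rank of 1 - projS. *)
Lemma rank_compress_aux (X : 'M[rat]_n) e r :
  (\rank (X * (projS * X) ^+ e * X ^+ r)%R <= \rank (X ^+ (e + r).+1)%R + e * t)%N.
Proof.
elim: e r => [|e IH] r; first by rewrite mulr1 -exprS addn0.
set Q := X * (projS * X) ^+ e.
have -> : X * (projS * X) ^+ e.+1 * X ^+ r =
    Q * X ^+ r.+1 - Q * (1 - projS) * X ^+ r.+1.
  by rewrite /Q exprSr exprS mulrBr mulr1 mulrBl opprB addrC subrK !mulrA.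
apply: leq_trans (mxrank_add _ _) _.
rewrite mxrank_opp mulSn addnCA addnC addSnnS leq_add //.
rewrite -!mulmxE; apply: leq_trans (mxrankM_maxl _ _) _.
by apply: leq_trans (mxrankM_maxr _ _) _; apply: rank_coprojS.
Qed.

Lemma rank_compress (X : 'M[rat]_n) e :
  (\rank ((projS * X * projS) ^+ e.+1)%R <= \rank (X ^+ e.+1)%R + e * t)%N.
Proof.
have -> : (projS * X * projS) ^+ e.+1 = projS * (X * (projS * X) ^+ e) * projS.
  elim: e => [|e IH]; first by rewrite mulr1.
  rewrite exprSr IH [in RHS]exprSr !mulrA -[_ * projS * projS]mulrA projS_idem.
  by rewrite ?mulrA.
rewrite -!mulmxE; apply: leq_trans (mxrankM_maxl _ _) _.
apply: leq_trans (mxrankM_maxr _ _) _; rewrite mulmxE.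
by have := rank_compress_aux X e 0; rewrite mulr1 addn0.
Qed.

End Compress.

Lemma tailsum_nat la t k :
  (tailsum la t = \sum_(t <= j < t + k) conj_part la j.+1 + tailsum la (t + k))%N.
Proof.
elim: k => [|k IH]; first by rewrite addn0 big_geq.
by rewrite addnS big_nat_recr ?leq_addr //= IH tailsumS addnA addnAC.
Qed.

Lemma tailsum_eq0 la t : (forall a, a \in la -> (a <= t)%N) -> tailsum la t = 0%N.
Proof.
move=> H; rewrite /tailsum big_seq big1 // => a /H; lia.
Qed.

(** With e the number of parts larger than t, the sum of the e largest parts is at
    least e t plus the sum of their excesses over t. *)
Lemma tailsum_sum_conj la t e : (forall a, a \in la -> (a <= head 0 la)%N) ->
  e = conj_part la t.+1 -> (0 < e)%N ->
  (tailsum la t + e * t <= \sum_(1 <= i < e.+1) conj_part (conj_seq la) i)%N.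
Proof.
move=> leh eE e0; rewrite sum_conj_part /conj_seq big_map.
rewrite -[X in iota 0 X]subn0 -/(index_iota 0 _); set h := head 0%N la.
have le_th : (t <= h)%N.
  by move: e0; rewrite eE -has_count => /hasP[a /leh]; rewrite -/h /= => H1 H2; lia.
rewrite (@big_cat_nat _ _ _ t) //= addnC leq_add //.
  have -> : (e * t = \sum_(0 <= j < t) e)%N by rewrite sum_nat_const_nat subn0 mulnC.
  rewrite big_nat [leqRHS]big_nat; apply: leq_sum => j /andP[_ ltj].
  by rewrite leq_min leqnn andbT eE leq_conj_part // ltnS ltnW.
rewrite (tailsum_nat la t (h - t)) subnKC // (tailsum_eq0 leh) addn0.
rewrite big_nat [leqRHS]big_nat; apply: leq_sum => j /andP[tj _].
by rewrite leq_min leqnn eE leq_conj_part.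
Qed.

Lemma part_leq_head la a : sorted geq la -> a \in la -> (a <= head 0 la)%N.
Proof.
case: la => //= c la pth; rewrite inE => /predU1P[->//|ala].
have geq_tr : transitive geq by move=> x y z /= hx hz; apply: leq_trans hx.
exact: (allP (order_path_min geq_tr pth)).
Qed.

Lemma conj_part_leq_sumn la t : (conj_part la t.+1 <= sumn la)%N.
Proof.
have -> : sumn la = tailsum la 0.
  by rewrite /tailsum sumnE; apply: eq_bigr => a _; rewrite subn0.
have := tailsumS la 0.
have : (conj_part la t.+1 <= conj_part la 1)%N by apply: leq_conj_part.
lia.
Qed.

Section Minors.
Variables (n k : nat) (la : intpart k).
Hypothesis hkn : (k <= n)%N.

(** The characteristic polynomial of - D X D, for the generic matrix X and the
    coordinate projection D onto S.  Its coefficients are sums of principal minors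
    of X inside S. *)
Definition gen_minors (S : {set 'I_n}) : {poly {mpoly rat[n * n]}} :=
  char_poly (- \matrix_(i, j) (if (i \in S) && (j \in S) then xvar i j else 0)).

Lemma diag_res_xvar (i j : 'I_n) :
  diag_res (xvar i j) = if i == j then 'X_i else 0 :> {mpoly rat[n]}.
Proof.
rewrite /diag_res /mx_subst /xvar mmapX mmap1U mxvecE !mxE.
by case: eqP => [->|_]; rewrite ?mulr1n ?mulr0n.
Qed.

Lemma diag_res_minors S d : (d <= n)%N ->
  diag_res (gen_minors S)`_(n - d) = esymS S d.
Proof.
move=> le_dn; rewrite /gen_minors -coef_map map_char_poly.
rewrite char_poly_trig; last first.
  apply/is_trig_mxP => i j lt_ij; rewrite !mxE.
  case: ifP => _; rewrite ?oppr0 ?raddf0 // raddfN /= diag_res_xvar.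
  by rewrite -val_eqE /= ltn_eqF ?oppr0.
pose u (i : 'I_n) : {mpoly rat[n]} := if i \in S then 'X_i else 0.
rewrite (eq_bigr (fun i => 'X + (u i)%:P)) => [|i _]; last first.
  rewrite !mxE raddfN polyCN opprK; congr (_ + _%:P); rewrite andbb /u.
  by case: ifP => _; rewrite ?raddf0 //= diag_res_xvar eqxx.
rewrite (eq_bigl (fun i => i \in [set: 'I_n])) => [|i]; last by rewrite inE.
rewrite coef_prod_XaddC cardsT card_ord ?leq_subr // subKn //.
rewrite (bigID (fun T : {set 'I_n} => T \subset S)) /= [X in _ + X]big1 ?addr0.
  apply: eq_big => T; first by rewrite subsetT andbC.
  by move=> /andP[_ /subsetP TS]; apply: eq_bigr => i /TS iS; rewrite /u iS.
by move=> T /andP[_ /subsetPn[i iT iS]]; rewrite (bigD1 i) //= /u (negPf iS) mul0r.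
Qed.

(** Taking for e the number of parts larger than n - |S| makes the bound on the
    rank of the e-th power of the compression sharp enough. *)
Lemma minors_vanish (S : {set 'I_n}) d : (d <= #|S|)%N ->
  (#|S| < d + tailsum la (n - #|S|))%N ->
  vanishing_ideal (@rank_variety n (conj_seq la)) (gen_minors S)`_(n - d).
Proof.
move=> le_dS lt X VX; rewrite /mx_eval -coef_map map_char_poly.
set t := (n - #|S|)%N in lt *.
have /and3P[sla _ /eqP sumla] := part_seqP la.
pose e := conj_part la t.+1.
have e0 : (0 < e)%N.
  rewrite lt0n; apply/eqP => e0; move: lt.
  rewrite (tailsum_eq0 (t := t)) ?addn0 ?ltnNge ?le_dS // => a ala; rewrite leqNgt.
  apply/negP => lta; move/eqP: e0; rewrite /e eqn0Ngt -has_count => /negP; apply.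
  by apply/hasP; exists a.
have le_en : (e <= n)%N by apply: leq_trans hkn; rewrite -sumla conj_part_leq_sumn.
have H1 := tailsum_sum_conj (t := t) (fun a => @part_leq_head la a sla) (erefl e) e0.
have := VX e; rewrite e0 le_en => /(_ isT).
rewrite mxrank_coker => H2.
have -> : map_mx (meval (mxvec X 0))
      (- \matrix_(i, j) (if (i \in S) && (j \in S) then xvar i j else 0)) =
    - (projS S * X * projS S).
  apply/matrixP => i j; rewrite -!mulmxE mul_mx_diag mul_diag_mx !mxE mevalN.
  case: (i \in S) => /=; last by rewrite mul0r mul0r meval0.
  by case: (j \in S); rewrite ?mulr1 ?mulr0 ?mul1r ?meval0 // mevalXU mxvecE.
apply: (@char_poly_coef0 _ _ _ e).
have -> : \rank ((- (projS S * X * projS S)) ^+ e)%R =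
    \rank ((projS S * X * projS S) ^+ e)%R.
  by rewrite -scaleN1r expmxZ mxrank_scale_nz // expf_neq0 // oppr_eq0 oner_eq0.
have := rank_compress S X e.-1; rewrite prednK //.
have := rank_leq_row (X ^+ e); have := max_card (mem S); rewrite card_ord -/t.
have : (e.-1 * t + t = e * t)%N by rewrite -{2}(prednK e0) mulSn addnC.
rewrite -/t in H1 *; lia.
Qed.

End Minors.

(** * The isomorphism *)

Lemma tailsum_leq la t : (tailsum la t <= sumn la - t)%N.
Proof.
rewrite /tailsum; elim: la => [|a la IH]; first by rewrite big_nil.
have : (\sum_(a <- la) (a - t) <= sumn la)%N.
  by rewrite sumnE; apply: leq_sum => c _; apply: leq_subr.
by rewrite big_cons /=; lia.
Qed.

Lemma pnm_tailsum n m la : (sumn la <= n)%N -> (m <= n)%N ->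
  pnm n m la = tailsum la (n - m).
Proof.
move=> le_sn le_mn; rewrite (tailsum_nat la (n - m) m) subnK //.
have := tailsum_leq la n; rewrite (eqP (_ : sumn la - n == 0)%N) // leqn0 => /eqP ->.
by rewrite addn0 /pnm big_add1.
Qed.

Section Assemble.
Variables (n' k : nat) (la : intpart k).
Local Notation n := n'.+1.
Hypothesis hkn : (k <= n)%N.
Local Notation P := {mpoly rat[n]}.
Local Notation Q := {mpoly rat[n * n]}.

Let sumla : (sumn la <= n)%N.
Proof. by have /and3P[_ _ /eqP ->] := part_seqP la. Qed.

(** A generator with d = 0 cannot occur, because la has at most n cells. *)
Lemma I_ideal_init (f : P) : init_ideal n la f -> I_ideal la f.
Proof.
apply: gen_idealS; first exact: gen_ideal_is_ideal.
move=> g [[S [d [_ lt ->]]]|[j]]; last by rewrite leqNgt ltn_ord.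
have leS : (#|S| <= n)%N by have := max_card (mem S); rewrite card_ord.
apply: gen_ideal_mem; exists S, d; rewrite pnm_tailsum //; split=> //.
rewrite lt0n; apply/eqP => d0; move: lt; rewrite d0 add0n ltnNge => /negP; apply.
apply: leq_trans (tailsum_leq _ _) _; lia.
Qed.

(** The section x_i |-> x_(i,i) of the restriction to diagonal matrices. *)
Definition diag_emb : P -> Q := mmap (@mpolyC _ rat) (fun i => xvar i i).

HB.instance Definition _ := GRing.RMorphism.copy diag_emb
  (mmap (@mpolyC _ rat) (fun i => xvar i i)).

Lemma diag_embX i : diag_emb 'X_i = xvar i i.
Proof. by rewrite /diag_emb mmapX mmap1U. Qed.

Lemma diag_embK p : diag_res (diag_emb p) = p.
Proof.
rewrite [p in RHS]mpolyE {1}[p]mpolyE (raddf_sum diag_emb) (raddf_sum (@diag_res n)).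
apply: eq_bigr => m _; rewrite /= -!mul_mpolyC !rmorphM /=.
rewrite {1}/diag_emb mmapC /diag_res /mx_subst mmapC; congr (_ * _).
rewrite [in LHS]mpolyXE_id -/(mx_subst _ _) -/(diag_res _) !rmorph_prod [RHS]mpolyXE_id /=.
by apply: eq_bigr => i _; rewrite !rmorphXn /= diag_embX diag_res_xvar eqxx.
Qed.

Lemma diag_emb_homog d p : p \is d.-homog -> diag_emb p \is d.-homog.
Proof.
move=> /dhomogP hp; rewrite /diag_emb /mmap big_seq; apply: rpred_sum => m /hp <-.
rewrite mul_mpolyC; apply: rpredZ; rewrite /= mdegE /mmap1.
elim/big_rec2: _ => [|i e q _ hq]; first exact: dhomog1.
apply: dhomogM hq; rewrite -[X in X.-homog]mul1n; apply: dhomogMn.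
by rewrite dhomogX /= mdeg1.
Qed.

Lemma diag_ideal_res (p : Q) : diag_ideal p -> diag_res p = 0.
Proof.
apply: (gen_idealS (I := fun p : Q => diag_res p = 0)).
  split=> [|q r q0 r0|a q q0]; first exact: raddf0.
    by rewrite raddfD /= q0 r0 addr0.
  by rewrite rmorphM /= q0 mulr0.
by move=> _ [i [j [/negPf ne ->]]]; rewrite diag_res_xvar ne.
Qed.

(** In particular, the kernel of the restriction is contained in [diag_ideal]. *)
Lemma diag_ideal_sub_res (p : Q) : diag_ideal (p - diag_emb (diag_res p)).
Proof.
have idD := gen_ideal_is_ideal (fun g => exists i j : 'I_n, i != j /\ g = xvar i j).
rewrite -/(@diag_ideal n) in idD.
pose phi q := diag_emb (@diag_res n q).
have phiM q r : phi (q * r) = phi q * phi r by rewrite /phi !rmorphM.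
rewrite -/(phi p); have -> : phi p = \sum_(m <- msupp p) (p@_m)%:MP * phi 'X_[m].
  rewrite {1}[p]mpolyE /phi (raddf_sum (@diag_res n)) (raddf_sum diag_emb).
  apply: eq_bigr => m _; rewrite /= -!mul_mpolyC !rmorphM /=.
  by rewrite {1}/diag_res /mx_subst mmapC {1}/diag_emb mmapC.
rewrite {1}[p]mpolyE -sumrB; apply: (ideal_sum _ idD) => m _.
rewrite -mul_mpolyC -mulrBr; apply: (idealM idD).
have IM (a a' c c' : Q) :
    diag_ideal (a - a') -> diag_ideal (c - c') -> diag_ideal (a * c - a' * c').
  move=> Ia Ic; have -> : a * c - a' * c' = c * (a - a') + a' * (c - c') by ring.
  by apply: (idealD idD); apply: (idealM idD).
have phi1 : phi 1 = 1 by rewrite /phi !rmorph1.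
rewrite mpolyXE_id (big_morph phi phiM phi1).
apply: (big_ind2 (fun a a' => diag_ideal (a - a'))) => [|*|l _].
- by rewrite subrr; apply: (ideal0 idD).
- exact: IM.
have Il : diag_ideal ('X_l - phi 'X_l).
  case/mxvec_indexP: l => i j; rewrite /phi -/(xvar i j) diag_res_xvar.
  case: (eqVneq i j) => [<-|ne]; first by rewrite diag_embX subrr; apply: (ideal0 idD).
  by rewrite raddf0 subr0; apply: gen_ideal_mem; exists i, j.
elim: (m l) => [|e IH]; first by rewrite phi1 subrr; apply: (ideal0 idD).
by rewrite !exprS phiM; apply: IM.
Qed.

Lemma I_ideal_lift (f : P) : I_ideal la f ->
  exists2 p, vanishing_ideal (@rank_variety n (conj_seq la)) p & diag_res p = f.
Proof.
have idV := vanishing_ideal_is_ideal (@rank_variety n (conj_seq la)).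
apply: (gen_idealS (I := fun f : P =>
  exists2 p, vanishing_ideal (@rank_variety n (conj_seq la)) p & diag_res p = f)).
  split=> [|_ _ [p Vp <-] [q Vq <-]|a _ [p Vp <-]].
  - by exists 0; [apply: (ideal0 idV) | rewrite raddf0].
  - by exists (p + q); [apply: (idealD idV) | rewrite raddfD].
  - by exists (diag_emb a * p); [apply: (idealM idV) | rewrite rmorphM /= diag_embK].
move=> _ [S [d [d0 lt ->]]].
have leS : (#|S| <= n)%N by have := max_card (mem S); rewrite card_ord.
case: (leqP d #|S|) => [le_d|lt_d].
  exists (gen_minors S)`_(n - d).
    by apply: minors_vanish => //; rewrite -pnm_tailsum.
  by apply: diag_res_minors; apply: leq_trans leS.
by exists 0; [apply: (ideal0 idV) | rewrite raddf0 esymS_gt].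
Qed.

Lemma I_ideal_res (p : Q) : vanishing_ideal (@rank_variety n (conj_seq la)) p ->
  I_ideal la (diag_res p).
Proof.
move=> Vp; apply/I_ideal_init/init_ideal_of_alt => // col dl fil _ q.
rewrite -[q]diag_embK -rmorphM /=; apply: (altf_diag_res fil).
rewrite mulrC; exact: (idealM (vanishing_ideal_is_ideal _)).
Qed.

(** The scheme-theoretic intersection is cut out, inside the diagonal matrices,
    by [I_ideal]. *)
Lemma OT_idealE (p : Q) : OT_ideal (conj la) p <-> I_ideal la (diag_res p).
Proof.
have idI := gen_ideal_is_ideal (@I_gen n la).
split=> [[q [r [Vq Dr ->]]]|/I_ideal_lift[q Vq qE]].
  by rewrite raddfD /= (diag_ideal_res Dr) addr0; apply: I_ideal_res.
exists q, (p - q); split=> //; last by rewrite addrC subrK.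
have := diag_ideal_sub_res (p - q).
by rewrite raddfB /= qE subrr raddf0 subr0.
Qed.

Local Notation A := (R_ring n la).
Local Notation B := (OT_ring hkn (conj la)).
Local Notation clA := (quot_class (I_hideal n la)).
Local Notation clB := (quot_class (OT_hideal hkn (conj la))).

Lemma clA_eq p q : clA p = clA q <-> I_ideal la (p - q).
Proof.
split=> [e|/(quot_class_eq0 (I_hideal n la))].
  by apply/(quot_class_eq0 (I_hideal n la)); rewrite raddfB /= e subrr.
by rewrite raddfB /= => /eqP; rewrite subr_eq0 => /eqP.
Qed.

Lemma clB_eq p q : clB p = clB q <-> I_ideal la (diag_res p - diag_res q).
Proof.
have resB : diag_res p - diag_res q = diag_res (p - q) by rewrite raddfB.
split=> [e|]; rewrite resB.
  by apply/OT_idealE/(quot_class_eq0 (OT_hideal hkn (conj la))); rewrite raddfB /= e subrr.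
move=> /OT_idealE/(quot_class_eq0 (OT_hideal hkn (conj la))).
by rewrite raddfB /= => /eqP; rewrite subr_eq0 => /eqP.
Qed.

(** x_i |-> x_(i,i) on the quotient rings, computed on representatives. *)
Definition coord_map (a : A) : B := clB (diag_emb (repr a)).

Lemma coord_mapE p : coord_map (clA p) = clB (diag_emb p).
Proof.
apply/clB_eq; rewrite !diag_embK; apply/clA_eq.
by rewrite /quot_class reprK.
Qed.

Lemma coord_map_is_zmod_morphism : zmod_morphism coord_map.
Proof.
move=> a c; have [p ->] := quot_class_surj a; have [q ->] := quot_class_surj c.
by rewrite -raddfB !coord_mapE !raddfB.
Qed.

Lemma coord_map_is_monoid_morphism : monoid_morphism coord_map.
Proof.
split=> [|a c]; first by rewrite -(rmorph1 clA) coord_mapE !rmorph1.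
have [p ->] := quot_class_surj a; have [q ->] := quot_class_surj c.
by rewrite -rmorphM !coord_mapE !rmorphM.
Qed.

HB.instance Definition _ :=
  GRing.isZmodMorphism.Build A B coord_map coord_map_is_zmod_morphism.
HB.instance Definition _ :=
  GRing.isMonoidMorphism.Build A B coord_map coord_map_is_monoid_morphism.

Lemma coord_map_bij : bijective coord_map.
Proof.
exists (fun c : B => clA (diag_res (repr c))) => a.
  have [p ->] := quot_class_surj a; rewrite coord_mapE.
  apply/clA_eq; rewrite -{2}[p]diag_embK; apply/clB_eq.
  by rewrite /quot_class reprK.
rewrite coord_mapE -[RHS](reprK a) -/(clB _); apply/clB_eq.
by rewrite diag_embK subrr; apply: ideal0; apply: gen_ideal_is_ideal.
Qed.

Lemma coord_map_graded d a : gr_piece d a <-> gr_piece d (coord_map a).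
Proof.
split=> [[p hp ->]|[q hq]].
  by exists (diag_emb p); [apply: diag_emb_homog | apply: coord_mapE].
have [p ->] := quot_class_surj a; rewrite coord_mapE => /clB_eq.
rewrite diag_embK => /clA_eq ->.
by exists (diag_res q) => //; apply: diag_res_homog.
Qed.

End Assemble.

Theorem corollary6p4 (n k : nat) (hk : (0 < k)%N) (hkn : (k <= n)%N)
    (la : intpart k) :
  exists f : {rmorphism R_ring n la -> OT_ring hkn (conj la)},
    graded_iso f /\
    forall i : 'I_n, f (quot_class (I_hideal n la) 'X_i) =
                     quot_class (OT_hideal hkn (conj la)) (xvar i i).
Proof.
case: n hkn => [|n] hkn; first by move: (leq_trans hk hkn).
exists (@coord_map n k la hkn); split.
  by split; [apply: coord_map_bij | apply: coord_map_graded].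
by move=> i; rewrite /= coord_mapE diag_embX.
Qed.
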